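(* Let $\mathbb{F}$ be a skew field and $\mathbb{A}(\mathbb{F})$ an affine geometry over $\mathbb{F}$. If $\mathcal{A}$ is a synthetic affinographic arrangement in $\mathbb{A}(\mathbb{F})$ with graph $\Delta$ (node set $N$), then affine coordinates $x_v$ ($v\in N$) on $\mathbb{A}(\mathbb{F})$ can be chosen and a gain graph $\Phi$ on $N$ without half edges, with gains in $\mathbb{F}^+$ and underlying simplification $\Delta$, can be found such that $\mathcal{A}=\mathcal{A}[\Phi]$, i.e., each hyperplane of $\mathcal{A}$ corresponds to an edge $e_{ij}$ of $\Phi$ and has equation $x_j-x_i=\varphi(e_{ij})$. Conversely, every coordinatized affinographic arrangement $\mathcal{A}[\Phi]$ is a synthetic affinographic arrangement.
   Context: An affine geometry is a projective geometry $\mathbb{P}$ with a hyperplane $h_\infty$ removed; the ideal part of an affine hyperplane $h$ is $h_{\mathbb{P}}\cap h_\infty$ ($h_{\mathbb{P}}$ its projective closure). A family $\mathcal{A}$ of affine hyperplanes is a synthetic affinographic arrangement if there is a simple graph $\Delta$ and a bijection from $E(\Delta)$ to the set of ideal parts of members of $\mathcal{A}$ which is an isomorphism from the graphic matroid $G(\Delta)$ to the matroid on these ideal parts whose rank is codimension in $h_\infty$ of their intersection. A gain graph with gains in $\mathbb{F}^+$ assigns to each link $e_{ij}$ (nodes $v_i,v_j$) an element $\varphi(e_{ij})\in\mathbb{F}$ with $\varphi(e_{ji})=-\varphi(e_{ij})$. For such $\Phi$ with node set $N$, the coordinatized affinographic arrangement $\mathcal{A}[\Phi]$ in $\mathbb{A}^N(\mathbb{F})$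 consists of the hyperplanes $h_e:\ x_j-x_i=\varphi(e_{ij})$, $e=e_{ij}\in E(\Phi)$.
   Formalization: Coordinates x_v (v in N) cannot identify A(F) with A^N(F) unless dim A(F) = |N| (three parallel classes of lines in a plane give K_3); here they form an affine map to A^N(F) that is injective or has independent coordinates, an isomorphism when dim A(F) = |N| is finite. *)

(* Defs.v *)
From HB Require Import structures.
From mathcomp Require Import all_boot all_order all_algebra.
From mathcomp Require Import boolp classical_sets functions cardinality.

Set Implicit Arguments.
Unset Strict Implicit.
Unset Printing Implicit Defensive.

Import GRing.Theory.
Local Open Scope classical_set_scope.
Local Open Scope ring_scope.

Definition skew_field (F : unitRingType) : Prop :=
  forall a : F, a != 0 -> a \is a GRing.unit.

(** Projective and affine geometry.  The projective geometry P(W) of a left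
    F-vector space W of arbitrary dimension is handled through the linear
    subspaces of W; all dimensions below are linear, hence codimensions agree
    with the projective ones. *)

Definition subspace (F : unitRingType) (W : lmodType F) (U : set W) : Prop :=
  U 0 /\ forall (a : F) (u v : W), U u -> U v -> U (a *: u + v).

(** H / U has a basis with n elements. *)
Definition codim (F : unitRingType) (W : lmodType F) (H U : set W) (n : nat)
    : Prop :=
  U `<=` H /\
  exists b : 'I_n -> W,
    (forall k, H (b k)) /\
    (forall w, H w ->
       exists! a : {ffun 'I_n -> F}, U (w - \sum_(k < n) a k *: b k)).

Definition hyperplane (F : unitRingType) (W : lmodType F) (H : set W) : Prop :=
  subspace H /\ codim setT H 1.

(** The points of the affine geometry are the lines of [proj] that are not
    contained in [ideal]. *)
Record affine_geometry (F : unitRingType) := AffineGeometry {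
  proj : lmodType F;
  ideal : set proj;
  ideal_hyperplane : hyperplane ideal }.
Arguments ideal {F} G : rename.

(** Affine hyperplanes are represented by their projective closures (the affine
    hyperplane itself is [h `\` ideal G]). *)
Definition affine_hyperplane (F : unitRingType) (G : affine_geometry F)
    (h : set (proj G)) : Prop :=
  hyperplane h /\ h <> ideal G.
Arguments affine_hyperplane {F} G h.

Definition ideal_part (F : unitRingType) (G : affine_geometry F)
    (h : set (proj G)) : set (proj G) :=
  h `&` ideal G.
Arguments ideal_part {F} G h.

(** Graphs. *)

Definition is_link (N : Type) (e : set N) : Prop :=
  exists i j : N, i <> j /\ e = [set i; j].

Record simple_graph (N : Type) := SimpleGraph {
  edges : set (set N);
  edges_link : forall e, edges e -> is_link e }.
Arguments edges {N} Delta : rename.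

Definition forest (N : choiceType) (S : set (set N)) : Prop :=
  forall c : seq N, (2 < size c)%N -> uniq c ->
    ~~ cycle (fun i j => [set i; j] \in S) c.

(** Rank in the graphic matroid, whose independent sets are the forests. *)
Definition graphic_rank (N : choiceType) (S : set (set N)) (r : nat) : Prop :=
  (exists T, [/\ T `<=` S, forest T & (T #= `I_r)%card]) /\
  (forall T, T `<=` S -> forest T -> (T #<= `I_r)%card).

(** The family A of affine hyperplanes is indexed by I, so repetitions are
    allowed.  When the graph is infinite its graphic matroid is finitary, i.e.
    determined by the ranks of the finite sets. *)
Definition synthetic_affinographic_with (F : unitRingType)
    (G : affine_geometry F) (I : Type) (A : I -> set (proj G))
    (N : choiceType) (Delta : simple_graph N) : Prop :=
  (forall k, affine_hyperplane G (A k)) /\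
  exists beta : set N -> set (proj G),
    set_bij (edges Delta) (range (fun k => ideal_part G (A k))) beta /\
    (forall S r, S `<=` edges Delta -> finite_set S -> graphic_rank S r ->
       codim (ideal G) (ideal G `&` \bigcap_(e in S) beta e) r).
Arguments synthetic_affinographic_with {F} G {I} A {N} Delta.

Definition synthetic_affinographic (F : unitRingType) (G : affine_geometry F)
    (I : Type) (A : I -> set (proj G)) : Prop :=
  exists (N : choiceType) (Delta : simple_graph N),
    synthetic_affinographic_with G A Delta.
Arguments synthetic_affinographic {F} G {I} A.

(** A gain graph with edge set E: every edge is a link (there are no half edges,
    and a loop would have the equation 0 = gain, which is not that of an affine
    hyperplane); parallel edges are allowed.  [gain e i j] is the gain of e in
    the direction from i to j, relevant only when i, j are the ends of e. *)
Record gain_graph (F : zmodType) (N E : Type) := GainGraph {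
  ends : E -> set N;
  gain : E -> N -> N -> F;
  ends_link : forall e, is_link (ends e);
  gainN : forall e i j, ends e = [set i; j] -> gain e j i = - gain e i j }.
Arguments ends {F N E} Phi e : rename.
Arguments gain {F N E} Phi e i j : rename.

Definition simplification_is (F : zmodType) (N E : Type)
    (Phi : gain_graph F N E) (Delta : simple_graph N) : Prop :=
  edges Delta = range (ends Phi).

(** The affine geometry A^N(F), in homogeneous coordinates: (X, t) with t != 0
    represents the point with affine coordinates t^-1 * X v, v in N. *)

Definition homog (F : unitRingType) (N : Type) : lmodType F :=
  ((N -> F^o) * F^o)%type.

Definition homog_ideal (F : unitRingType) (N : Type) : set (homog F N) :=
  [set p | p.2 = 0].

Lemma homog_ideal_hyperplane (F : unitRingType) (N : Type) :
  hyperplane (@homog_ideal F N).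
Proof.
split.
  split=> //= a u v; rewrite /homog_ideal /= => -> ->.
  by rewrite scaler0 addr0.
split=> //; exists (fun=> (0, 1) : homog F N); split=> // w _.
have E (a : F) : (w - a *: ((0, 1) : homog F N)).2 = w.2 - a.
  by rewrite -[in RHS](mulr1 a).
exists [ffun=> w.2]; split.
  by rewrite /homog_ideal big_ord1 ffunE /mkset E subrr.
move=> a; rewrite /homog_ideal big_ord1 /mkset E => /eqP.
by rewrite subr_eq0 => /eqP wa; apply/ffunP=> k; rewrite ffunE ord1 wa.
Qed.

Definition affine_space (F : unitRingType) (N : Type) : affine_geometry F :=
  AffineGeometry (@homog_ideal_hyperplane F N).

(** Affine coordinates indexed by N on an affine geometry G are given by a
    linear map c into homogeneous coordinates that respects the ideal
    hyperplanes.  The map must have the largest rank that dim G and #|N| allow: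
    it is one-to-one (a point is determined by its coordinates), or the
    coordinates are independent (finitely many of them take arbitrary values
    simultaneously).  When dim G = #|N| is finite, this says that c is an
    isomorphism from G onto A^N(F). *)
Definition affine_coordinates (F : unitRingType) (G : affine_geometry F)
    (N : choiceType) (c : {linear proj G -> homog F N}) : Prop :=
  ideal G = c @^-1` @homog_ideal F N /\
  (injective c \/
   forall (s : seq N) (p : homog F N),
     exists w, (c w).2 = p.2 /\ forall v, v \in s -> (c w).1 v = p.1 v).
Arguments affine_coordinates {F} G {N} c.

Definition coord (F : unitRingType) (W : lmodType F) (N : Type)
    (c : W -> homog F N) (v : N) (w : W) : F :=
  (c w).2^-1 * (c w).1 v.

(** The (projective closure of the) hyperplane x_j - x_i = gain e i j with
    respect to the coordinates c; see [affinographicE]. *)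
Definition affinographic (F : unitRingType) (W : lmodType F) (N E : Type)
    (c : W -> homog F N) (Phi : gain_graph F N E) (e : E) : set W :=
  [set w | forall i j, ends Phi e = [set i; j] ->
     (c w).1 j - (c w).1 i = (c w).2 * gain Phi e i j].

Lemma affinographicE (F : unitRingType) (W : lmodType F) (N E : Type)
    (c : W -> homog F N) (Phi : gain_graph F N E) (e : E) (w : W) :
  skew_field F -> ~ homog_ideal (c w) ->
  affinographic c Phi e w <->
  (forall i j, ends Phi e = [set i; j] ->
     coord c j w - coord c i w = gain Phi e i j).
Proof.
move=> hF /eqP /hF tU; rewrite /coord; split=> h i j /h.
  by rewrite -mulrBr => ->; rewrite mulKr.
by rewrite -mulrBr => <-; rewrite mulVKr.
Qed.

(* Main.v *)
Require Import Defs.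
From HB Require Import structures.
From mathcomp Require Import all_boot all_order all_algebra finmap.
From mathcomp Require Import boolp classical_sets functions cardinality.

(** Represent every ideal part by a linear form f_e on the projective space.
    Over a finite set of edges avoiding a node w, two edges at w that lie on a
    common circuit have forms that are proportional in exactly one way, because
    an edge at w is independent of all edges avoiding w.  This scales
    the forms at each node consistently.  The two scalars an edge gets from its
    ends differ by a gain in the multiplicative group of F, which is trivial on
    every circuit (a circuit carries one linear dependency), so it has a
    potential and the forms can be scaled globally so that they sum to zero
    around every circuit.  They are then the differences y_j - y_i of a
    potential y with values in the dual space, and an affine hyperplane with
    ideal part y_j = y_i has an equation y_j - y_i = constant.

    The potential is free up to one linear form for each component of the graph.
    A maximal matching between independent vectors of the common kernel of the
    y_v and the components exhausts one of the two sides; its dual functionals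
    make the coordinates injective or independent, respectively. *)

Set Implicit Arguments.
Unset Strict Implicit.
Unset Printing Implicit Defensive.

Import GRing.Theory.
Local Open Scope classical_set_scope.
Local Open Scope ring_scope.

(** * Linear algebra over a skew field *)

Section Subspaces.
Variables (F : unitRingType) (W : lmodType F).
Implicit Types (U V K : set W) (L : set W).

Lemma subspaceD U u v : subspace U -> U u -> U v -> U (u + v).
Proof. by move=> [_ h] uU vU; have := h 1 u v uU vU; rewrite scale1r. Qed.

Lemma subspaceZ U a u : subspace U -> U u -> U (a *: u).
Proof. by move=> [h0 h] uU; have := h a u 0 uU h0; rewrite addr0. Qed.

Lemma subspaceB U u v : subspace U -> U u -> U v -> U (u - v).
Proof.
by move=> [h0 h] uU vU; have := h (-1) v u vU uU; rewrite scaleN1r addrC.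
Qed.

Lemma subspace_sum U (I : Type) (s : seq I) (P : pred I) (w : I -> W) :
  subspace U -> (forall i, U (w i)) -> U (\sum_(i <- s | P i) w i).
Proof.
move=> sU h; elim/big_ind: _ => //; first by case: sU.
by move=> x y; apply: subspaceD.
Qed.

Lemma subspaceI U V : subspace U -> subspace V -> subspace (U `&` V).
Proof.
move=> [u0 uU] [v0 vV]; split=> // a x y [xU xV] [yU yV].
by split; [apply: uU|apply: vV].
Qed.

Lemma subspace_bigcap (I : Type) (S : set I) (B : I -> set W) :
  (forall i, S i -> subspace (B i)) -> subspace (\bigcap_(i in S) B i).
Proof.
move=> h; split=> [i /h []//|a x y hx hy i Si].
by have [_ hi] := h i Si; apply: hi; [apply: hx|apply: hy].
Qed.

(** Encoded as an intersection, so that membership is used by exhibiting one subspace, without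
    linear combinations. *)
Definition lspan L : set W := [set w | forall U, subspace U -> L `<=` U -> U w].

Lemma lspan_subspace L : subspace (lspan L).
Proof.
split=> [U []//|a u v hu hv U sU LU].
by case: (sU) => _; apply; [apply: hu|apply: hv].
Qed.

Lemma sub_lspan L : L `<=` lspan L.
Proof. by move=> w Lw U _; apply. Qed.

Lemma lspan_min L U : subspace U -> L `<=` U -> lspan L `<=` U.
Proof. by move=> sU LU w; apply. Qed.

Lemma lspan_mono L L' : L `<=` L' -> lspan L `<=` lspan L'.
Proof.
move=> h; apply: lspan_min (@lspan_subspace _) _ => w /h; exact: sub_lspan.
Qed.

Lemma lspan0 w : lspan set0 w -> w = 0.
Proof.
move=> /(_ [set 0]); apply=> //; split=> // a u v -> ->.
by rewrite /= scaler0 addr0.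
Qed.

Lemma line_sum_subspace U (b : W) :
  subspace U -> subspace [set w | exists a, U (w - a *: b)].
Proof.
move=> sU; split; first by exists 0; rewrite scale0r subr0; case: sU.
move=> a u v [x hx] [y hy]; exists (a * x + y).
rewrite scalerDl -scalerA opprD addrACA -scalerBr.
by case: sU => _; apply.
Qed.

Lemma lspan_setU1 L b w : lspan (b |` L) w -> exists a, lspan L (w - a *: b).
Proof.
move=> /(_ [set x | exists a, lspan L (x - a *: b)]); apply.
  exact: line_sum_subspace (@lspan_subspace _).
move=> x [->|Lx]; [exists 1|exists 0].
  by rewrite scale1r subrr; case: (lspan_subspace L).
by rewrite scale0r subr0; apply: sub_lspan.
Qed.

End Subspaces.

Section Functionals.
Variables (F : unitRingType) (hF : skew_field F) (W : lmodType F).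
Implicit Types (U V K : set W) (L : set W) (f g : W -> F).

Definition lin f : Prop := forall a u v, f (a *: u + v) = a * f u + f v.

Lemma linD f u v : lin f -> f (u + v) = f u + f v.
Proof. by move=> h; rewrite -[u]scale1r h mul1r scale1r. Qed.

Lemma lin0 f : lin f -> f 0 = 0.
Proof.
move=> h; have /eqP := linD 0 0 h.
by rewrite addr0 -subr_eq0 opprD addNKr oppr_eq0 => /eqP.
Qed.

Lemma linZ f a u : lin f -> f (a *: u) = a * f u.
Proof. by move=> h; rewrite -[a *: u]addr0 h lin0 // addr0. Qed.

Lemma linN f u : lin f -> f (- u) = - f u.
Proof. by move=> h; rewrite -scaleN1r linZ // mulN1r. Qed.

Lemma linB f u v : lin f -> f (u - v) = f u - f v.
Proof. by move=> h; rewrite linD // linN. Qed.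

Lemma lin_sum f (I : Type) (s : seq I) (P : pred I) (w : I -> W) :
  lin f -> f (\sum_(i <- s | P i) w i) = \sum_(i <- s | P i) f (w i).
Proof.
by move=> h; apply: (big_morph f (fun x y => linD x y h) (lin0 h)).
Qed.

Lemma lin_cst0 : lin (fun=> 0).
Proof. by move=> a u v; rewrite mulr0 addr0. Qed.

Lemma lin_add f g : lin f -> lin g -> lin (fun w => f w + g w).
Proof. by move=> hf hg a u v; rewrite hf hg mulrDr addrACA. Qed.

Lemma lin_opp f : lin f -> lin (fun w => - f w).
Proof. by move=> hf a u v; rewrite hf opprD mulrN. Qed.

(** Scaling a form on the left may destroy [lin] over a noncommutative field, so coefficients of
    forms always stand on the right. *)
Lemma lin_mulr f b : lin f -> lin (fun w => f w * b).
Proof. by move=> hf a u v; rewrite hf mulrDl mulrA. Qed.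

Lemma ker_subspace f : lin f -> subspace [set w | f w = 0].
Proof.
by move=> hf; split=> [|a u v /= hu hv] /=; rewrite ?lin0 // hf hu hv mulr0 addr0.
Qed.

Lemma skew_unit (a : F) : (a \is a GRing.unit) = (a != 0).
Proof.
by apply/idP/idP => [|/hF//]; apply: contraTneq => ->; rewrite unitr0.
Qed.

Lemma skew_mulf_eq0 (a b : F) : (a * b == 0) = (a == 0) || (b == 0).
Proof.
apply/idP/orP => [|[]/eqP ->]; rewrite ?mul0r ?mulr0 //.
have [->|/hF ua] := eqVneq a 0; first by left.
by move=> /eqP ab; right; rewrite -(mulKr ua b) ab mulr0.
Qed.

Lemma subspaceZ_inv U a u : subspace U -> a != 0 -> U (a *: u) -> U u.
Proof.
move=> sU /hF ua /(subspaceZ a^-1 sU).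
by rewrite scalerA mulVr // scale1r.
Qed.

(** The value at [w] is the coefficient of [b] modulo [V]. It is unique because [b] is not in [V],
    and uniqueness makes the chosen function linear. *)
Lemma kernel_functional V b : subspace V -> ~ V b ->
    (forall w, exists a, V (w - a *: b)) ->
  exists f, [/\ lin f, f b = 1 & forall w, V w <-> f w = 0].
Proof.
move=> sV nVb /choice[f hf].
have uniq_f w a : V (w - a *: b) -> f w = a.
  move=> hw; have := subspaceB sV hw (hf w).
  rewrite opprB addrC addrA subrK -scalerBl.
  have [|ne] := eqVneq (f w - a) 0; first by move=> /eqP; rewrite subr_eq0 => /eqP.
  by move=> /(subspaceZ_inv sV ne).
exists f; split.
- move=> a u v; apply: uniq_f.
  rewrite scalerDl -scalerA opprD addrACA -scalerBr.
  by case: (sV) => _; apply.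
- by apply: uniq_f; rewrite scale1r subrr; case: sV.
- move=> w; split=> [hw|fw0]; first by apply: uniq_f; rewrite scale0r subr0.
  by have := hf w; rewrite fw0 scale0r subr0.
Qed.

Lemma hyperplane_functional V : hyperplane V ->
  exists f b, [/\ lin f, f b = 1 & forall w, V w <-> f w = 0].
Proof.
move=> [sV [_ [b [_ hb]]]].
have nVb : ~ V (b ord0).
  move=> Vb; have [a [_ ua]] := hb 0 I.
  have h c : V (0 - \sum_(k < 1) [ffun=> c] k *: b k).
    by rewrite big_ord1 ffunE sub0r -scaleNr; apply: subspaceZ.
  have := etrans (esym (ua _ (h 0))) (ua _ (h 1)).
  by move=> /ffunP /(_ ord0); rewrite !ffunE => /eqP; rewrite eq_sym oner_eq0.
have [w|f [lf fb fV]] := kernel_functional sV nVb; last by exists f, (b ord0).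
have [a [ha _]] := hb w I; exists (a ord0).
by rewrite big_ord1 in ha.
Qed.

(* A maximal subspace containing U but not b is the kernel of the functional. *)
Lemma separating_functional U b : subspace U -> ~ U b ->
  exists f, [/\ lin f, f b = 1 & forall w, U w -> f w = 0].
Proof.
move=> sU nUb.
pose P := [set A : set W | A = set0 \/ [/\ subspace A, U `<=` A & ~ A b]].
have [|A [PA maxA]] := @Zorn_bigcup W P.
  move=> C CP Ctot.
  have [[A [CA A0]]|/forallNP h] := pselect (exists A, C A /\ A <> set0); last first.
    left; apply/seteqP; split=> // w [A CA Aw].
    by have /not_andP[//|/contrapT A0] := h A; rewrite A0 in Aw.
  have good B x : C B -> B x -> [/\ subspace B, U `<=` B & ~ B b].
    by move=> CB Bx; have [B0|//] := CP B CB; rewrite B0 in Bx.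
  have [a Aa] : A !=set0 by apply/set0P/eqP.
  have [sA UA nAb] := good A a CA Aa.
  right; split.
  - split; first by exists A => //; case: sA.
    move=> c u v [B CB Bu] [D CD Dv].
    have [BD|DB] := Ctot B D CB CD.
      have [sD _ _] := good D v CD Dv.
      by exists D => //; case: sD => _; apply => //; apply: BD.
    have [sB _ _] := good B u CB Bu.
    by exists B => //; case: sB => _; apply => //; apply: DB.
  - by move=> u /UA; exists A.
  - by move=> [B CB Bb]; have [_ _] := good B b CB Bb; apply.
have max' B : A `<=` B -> P B -> B = A.
  move=> AB PB; apply/seteqP; split=> //; apply: contrapT => nBA.
  by apply: (maxA B).
have [sA UA nAb] : [/\ subspace A, U `<=` A & ~ A b].
  case: PA => [A0|//].
  have U0 : U = A by apply: max'; [rewrite A0|right; split].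
  by case: (sU); rewrite {1}U0 A0.
have [w|f [lf fb fA]] := kernel_functional sA nAb; last first.
  by exists f; split=> // w /UA /fA.
have [Aw|nAw] := pselect (A w); first by exists 0; rewrite scale0r subr0.
(* For [w] outside [A], maximality forces [b] into the span of [A] and [w], with a nonzero
   coefficient at [w]; solving for [w] gives the multiple of [b]. *)
pose B := [set x | exists a, A (x - a *: w)].
have sB : subspace B by apply: line_sum_subspace.
have AB : A `<=` B by move=> x Ax; exists 0; rewrite scale0r subr0.
have Bb : B b.
  apply: contrapT => nBb.
  have BA : B = A by apply: max' => //; right; split=> // x /UA /AB.
  apply: nAw; rewrite -BA; exists 1; rewrite scale1r subrr; by case: sA.
have [a ha] := Bb.
have a0 : a != 0 by apply/eqP => a0; rewrite a0 scale0r subr0 in ha.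
exists a^-1; have := subspaceZ (- a^-1) sA ha.
by rewrite scalerBr scalerA mulNr mulVr ?hF // scaleN1r opprK scaleNr addrC.
Qed.

(** Unless [g] vanishes on [U], pick [x] in [U] with [g x] nonzero: subtracting from [w] the
    multiple of [x] that kills [g w] shows that [b] is [(g x)^-1 * f x]. *)
Lemma lin_factor U f g : subspace U -> lin f -> lin g ->
    (forall w, U w -> g w = 0 -> f w = 0) ->
  exists b, forall w, U w -> f w = g w * b.
Proof.
move=> sU lf lg h.
have [[x [Ux gx]]|/forallNP nx] := pselect (exists x, U x /\ g x <> 0); last first.
  exists 0 => w Uw; rewrite mulr0; apply: h => //.
  by have /not_andP[//|/contrapT] := nx w.
have ux : g x \is a GRing.unit by apply/hF/eqP.
exists ((g x)^-1 * f x) => w Uw.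
have := h (w - (g w * (g x)^-1) *: x).
rewrite !linB // !linZ // mulrVK // subrr => h0.
apply/eqP; rewrite mulrA -subr_eq0; apply/eqP/h0 => //.
by apply: subspaceB => //; apply: subspaceZ.
Qed.

(** Induction with [U] varying: on the kernel of [g t] the other forms already express [f], and the
    remaining difference vanishes wherever [g t] does. *)
Lemma lin_span (T : eqType) (s : seq T) (g : T -> W -> F) U f :
    subspace U -> uniq s -> lin f -> (forall t, lin (g t)) ->
    (forall w, U w -> (forall t, t \in s -> g t w = 0) -> f w = 0) ->
  exists a : T -> F, forall w, U w -> f w = \sum_(t <- s) g t w * a t.
Proof.
move=> sU us lf lg; elim: s us f lf U sU => [_|t s IH /= /andP[ts us]] f lf U sU h.
  by exists (fun=> 0) => w Uw; rewrite big_nil h.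
have [|w [Uw /= tw] sw|a ha] := IH us f lf (U `&` [set w | g t w = 0]).
- by apply: subspaceI => //; apply: ker_subspace.
- by apply: h => // t'; rewrite inE => /predU1P[->|/sw].
have lsum : lin (fun w => \sum_(t <- s) g t w * a t).
  move=> c u v; rewrite mulr_sumr -big_split /=; apply: eq_bigr => i _.
  by rewrite lg mulrDl mulrA.
have [w Uw tw|b hb] := lin_factor sU (lin_add lf (lin_opp lsum)) (lg t).
  by rewrite ha ?subrr.
exists (fun t' => if t' == t then b else a t') => w Uw.
rewrite big_cons eqxx -hb //= [X in _ + X](_ : _ = \sum_(t <- s) g t w * a t).
  by rewrite subrK.
rewrite !big_seq; apply: eq_bigr => i si; case: eqP => // it.
by rewrite -it si in ts.
Qed.

Lemma row_dependency m n (A : 'I_m -> 'I_n -> F) : (n < m)%N ->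
  exists c : 'I_m -> F, (exists i, c i != 0) /\
    forall j, \sum_(i < m) c i * A i j = 0.
Proof.
elim: n m A => [|n IH] [|m] A //= nm.
  by exists (fun=> 1); split=> [|[]//]; exists ord0; rewrite oner_eq0.
have [[i0 hi0]|/forallNP all0] := pselect (exists i, A i ord0 != 0); last first.
  have [|c [nz hc]] := IH m.+1 (fun i j => A i (lift ord0 j)); first exact: ltnW.
  exists c; split=> // j; have [j' ->|->] := unliftP ord0 j; first exact: hc.
  rewrite big1 // => i _; have /negP := all0 i; rewrite negbK => /eqP ->.
  by rewrite mulr0.
(* Gaussian elimination: [q i] is the multiple of the pivot row [i0] that clears the first column.
   The coefficient of the pivot row in [c'] compensates for these subtractions. *)
pose p := A i0 ord0; pose q i := A (lift i0 i) ord0 * p^-1.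
have [//|c [[k ck] hc]] := IH m (fun i j =>
  A (lift i0 i) (lift ord0 j) - q i * A i0 (lift ord0 j)).
pose c' i := if unlift i0 i is Some i' then c i' else - \sum_(l < m) c l * q l.
have c'i0 : c' i0 = - \sum_(l < m) c l * q l by rewrite /c' unlift_none.
have c'l l : c' (lift i0 l) = c l by rewrite /c' liftK.
exists c'; split; first by exists (lift i0 k); rewrite c'l.
move=> j; rewrite (bigD1_ord i0) //= c'i0; under eq_bigr do rewrite c'l.
rewrite mulNr mulr_suml -sumrN -big_split /=.
have [j' ->|->] := unliftP ord0 j; last first.
  rewrite big1 // => i _; rewrite /q -mulrA mulrVK ?hF //.
  exact: addNr.
rewrite -[RHS](hc j'); apply: eq_bigr => i _.
by rewrite mulrBr addrC /q !mulrA.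
Qed.

Lemma codim_independent (H U : set W) n k (v : 'I_k -> W) :
    subspace U -> codim H U n -> (forall i, H (v i)) ->
    (forall c : 'I_k -> F, U (\sum_(i < k) c i *: v i) -> forall i, c i = 0) ->
  (k <= n)%N.
Proof.
move=> sU [_ [b [_ hb]]] Hv ind; rewrite leqNgt; apply/negP => nk.
have /choice[A hA] : forall i, exists a : {ffun 'I_n -> F},
    U (v i - \sum_(j < n) a j *: b j).
  by move=> i; have [a [ha _]] := hb _ (Hv i); exists a.
have [c [[i ci] hc]] := row_dependency (fun i j => A i j) nk.
have /ind/(_ i)/eqP : U (\sum_(i < k) c i *: v i); last by rewrite (negbTE ci).
have : U (\sum_(i < k) c i *: (v i - \sum_(j < n) A i j *: b j)).
  by apply: subspace_sum => // l; apply: subspaceZ.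
under eq_bigr do rewrite scalerBr.
rewrite sumrB [X in _ - X](_ : _ = 0) ?subr0 //.
under eq_bigr do rewrite scaler_sumr.
rewrite exchange_big big1 //= => j _.
under eq_bigr do rewrite scalerA.
by rewrite -scaler_suml hc scale0r.
Qed.

Lemma codim_basis_independent (H U : set W) n : subspace H -> subspace U ->
  codim H U n -> exists b : 'I_n -> W, (forall i, H (b i)) /\
    (forall c : 'I_n -> F, U (\sum_(i < n) c i *: b i) -> forall i, c i = 0).
Proof.
move=> sH sU [_ [b [Hb hb]]]; exists b; split=> // c hc i.
have [a [_ ua]] := hb 0 (proj1 sH).
have h1 : U (0 - \sum_(k < n) [ffun j => - c j] k *: b k).
  rewrite sub0r -sumrN (eq_bigr (fun i => c i *: b i)) // => j _.
  by rewrite ffunE scaleNr opprK.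
have h0 : U (0 - \sum_(k < n) [ffun j => 0] k *: b k).
  rewrite big1 ?subr0 => [|j _]; first by case: sU.
  by rewrite ffunE scale0r.
have := etrans (esym (ua _ h1)) (ua _ h0) => /ffunP/(_ i).
by rewrite !ffunE => /eqP; rewrite oppr_eq0 => /eqP.
Qed.

Lemma codim_unique (H U : set W) n m : subspace H -> subspace U ->
  codim H U n -> codim H U m -> n = m.
Proof.
move=> sH sU cn cm; apply/eqP; rewrite eqn_leq.
have [b [Hb ib]] := codim_basis_independent sH sU cn.
have [d [Hd id]] := codim_basis_independent sH sU cm.
by rewrite (codim_independent sU cm Hb ib) (codim_independent sU cn Hd id).
Qed.

(** A vector of [U] outside [V], joined to [n] vectors independent modulo [U], would give [n.+1]
    vectors independent modulo [V]. *)
Lemma codim_eq (H U V : set W) n : subspace H -> subspace U -> subspace V ->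
  codim H U n -> codim H V n -> V `<=` U -> U `<=` V.
Proof.
move=> sH sU sV cU cV VU x Ux; apply: contrapT => nVx.
have [b [Hb ib]] := codim_basis_independent sH sU cU.
pose v (i : 'I_n.+1) := if unlift ord0 i is Some j then b j else x.
have v0 : v ord0 = x by rewrite /v unlift_none.
have vl j : v (lift ord0 j) = b j by rewrite /v liftK.
suff : (n.+1 <= n)%N by rewrite ltnn.
apply: (codim_independent (v := v) sV cV).
  move=> i; rewrite /v; case: unliftP => // _; exact: (proj1 cU).
move=> c; rewrite big_ord_recl v0; under eq_bigr do rewrite vl.
move=> hV; have cb j : c (lift ord0 j) = 0.
  apply: (ib (fun j => c (lift ord0 j))).
  have := subspaceB sU (VU _ hV) (subspaceZ (c ord0) sU Ux).
  by rewrite addrC addKr.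
move=> i; case: (unliftP ord0 i) => [j|] -> //.
apply/eqP; apply: contraT => c0.
suff /(subspaceZ_inv sV c0) : V (c ord0 *: x) by [].
by move: hV; rewrite big1 ?addr0 // => j _; rewrite cb scale0r.
Qed.

End Functionals.

(** * Forests and the graphic rank *)

Section CardSetU1.
Local Open Scope card_scope.
Variable T : choiceType.
Implicit Types (A : set T) (x : T) (n : nat).

Lemma card_setU1 A x n : A #= `I_n -> ~ A x -> (x |` A) #= `I_n.+1.
Proof.
move=> An nAx; have fA : finite_set A by apply/finite_setP; exists n.
have /finite_setP[m Am] : finite_set (x |` A) by rewrite finite_setU.
suff <- : m = n.+1 by [].
rewrite -(card_fset_set Am) -(card_fset_set An) fset_setU1 // cardfsU1.
rewrite in_fset_set //; case: (boolP (x \in A)) => [/set_mem//|_].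
by rewrite add1n.
Qed.

Lemma card_setD1 A x n : A #= `I_n.+1 -> A x -> (A `\ x) #= `I_n.
Proof.
move=> An Ax; have fA : finite_set A by apply/finite_setP; exists n.+1.
have /finite_setP[m Am] : finite_set (A `\ x) by apply: finite_setD.
have := card_setU1 Am (x := x); rewrite setD1K // => /(_ (fun h => h.2 erefl)) Am1.
have /card_eq_II[->//] : (`I_n.+1 #= `I_m.+1).
by rewrite card_eq_sym in An; apply: card_eq_trans An Am1.
Qed.

End CardSetU1.

Section Forests.
Variable N : choiceType.
Implicit Types (S T : set (set N)) (X : set N) (x i j : N) (p c : seq N).

Lemma set2_eq (a b i j : N) : [set a; b] = [set i; j] ->
  a = i /\ b = j \/ a = j /\ b = i.
Proof.
move=> h; have : [set i; j] a by rewrite -h; left.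
have : [set i; j] b by rewrite -h; right.
have : [set a; b] i by rewrite h; left.
have : [set a; b] j by rewrite h; right.
by move=> [] h1 [] h2 [] h3 [] h4; simpl in h1, h2, h3, h4; subst; auto.
Qed.

(** Such an [X] is a union of components of the graph [S]; it expresses that two nodes are
    disconnected without mentioning paths. *)
Definition edge_closed S X := forall a b, S [set a; b] -> X a -> X b.

Lemma edge_closedC S X : edge_closed S X -> edge_closed S (~` X).
Proof. by move=> h a b; rewrite setUC => /h ba nXa /ba. Qed.

Lemma edge_closed_sub S T X : T `<=` S -> edge_closed S X -> edge_closed T X.
Proof. by move=> TS h a b /TS /h. Qed.

Lemma forest_sub S T : T `<=` S -> forest S -> forest T.
Proof.
move=> TS fS c c2 uc; apply: contra (fS c c2 uc); apply: sub_cycle => a b.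
by move=> /set_mem /TS /mem_set.
Qed.

Lemma forest0 : forest (set0 : set (set N)).
Proof.
move=> [|x p] // _ _; apply/negP.
by case: p => [|y p] /= /andP[/set_mem].
Qed.

Lemma last_next x p : uniq (x :: p) -> next (x :: p) (last x p) = x.
Proof.
by move=> /cycle_next; rewrite /= rcons_path => /andP[_ /eqP].
Qed.

Lemma path_next x p : uniq (x :: p) -> path (frel (next (x :: p))) x p.
Proof. by move=> /cycle_next; rewrite /= rcons_path => /andP[]. Qed.

Lemma rot_to_next c x : uniq c -> x \in c ->
  exists k p, rot k c = next c x :: p /\ last (next c x) p = x.
Proof.
move=> uc xc; have /rot_to[k p kc] : next c x \in c by rewrite mem_next.
exists k, p; split=> //; have uk : uniq (rot k c) by rewrite rot_uniq.
have := last_next (x := next c x) (p := p); rewrite -kc => /(_ uk).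
by rewrite next_rot // => /(can_inj (prev_next uc)).
Qed.

(** The first step cannot go to [i], which is kept for the end, so it uses [T] and stays outside
    [X]. The later edges avoid [j], hence also lie in [T], and the path never enters [X]. *)
Lemma no_cycle_through_bridge T X i j p : edge_closed T X -> X i -> ~ X j ->
  path (fun a b => [set a; b] \in [set i; j] |` T) j p -> uniq (j :: p) ->
  (1 < size p)%N -> last j p <> i.
Proof.
move=> clX Xi nXj; case: p => // q p /= /andP[/set_mem jq qp] /and3P[jqp qp' up] sp lp.
have [qi|qi] := eqVneq q i.
  case: p sp {qp jqp up} lp qp' => // r p _ /= lp.
  by rewrite qi -lp mem_last.
have nXq : ~ X q.
  case: jq => [/set2_eq[[ji _]|[_ /eqP]]|]; last by rewrite setUC => /clX h /h.
    by rewrite ji in nXj.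
  by rewrite (negbTE qi).
apply: nXj; case: nXq; suff : X (last q p) -> X q by apply; rewrite lp.
elim: p q qp jqp {jq qi qp' up sp lp} => //= r p IH q /andP[/set_mem qr rp].
rewrite inE negb_or => /andP[jq jrp] /(IH _ rp jrp) Xr.
case: qr => [/set2_eq[[_ rj]|[qj _]]|]; last by rewrite setUC => /clX; apply.
  by rewrite inE rj eqxx in jrp.
by rewrite qj eqxx in jq.
Qed.

(** A cycle must use the new edge, because [T] is a forest. Cut open there, it is a path ruled out
    by [no_cycle_through_bridge]; the other direction of travel uses the complement of [X]. *)
Lemma forest_bridge T X i j : forest T -> edge_closed T X -> X i -> ~ X j ->
  forest ([set i; j] |` T).
Proof.
move=> fT clX Xi nXj c c2 uc; apply/negP => cyc.
have [x [xc nTx]] : exists x, x \in c /\ ~ T [set x; next c x].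
  apply: contrapT => /forallNP h; have /negP := fT c c2 uc; apply.
  apply: cycle_from_next => // x xc; apply/mem_set.
  by have /not_andP[//|/contrapT] := h x.
have [k [p [kc lp]]] := rot_to_next uc xc.
have uk : uniq (next c x :: p) by rewrite -kc rot_uniq.
have sk : (1 < size p)%N by rewrite -(size_rot k) kc in c2.
have : path (fun a b => [set a; b] \in [set i; j] |` T) (next c x) p.
  by have := cyc; rewrite -(rot_cycle k) kc /= rcons_path => /andP[].
have [/set2_eq[[xi nj]|[xj ni]]|//] := set_mem (next_cycle cyc xc).
  rewrite nj xi in uk lp *; move=> pth.
  exact: no_cycle_through_bridge clX Xi nXj pth uk sk lp.
rewrite ni xj (setUC [set i]) in uk lp *; move=> pth.
by apply: (no_cycle_through_bridge (edge_closedC clX) nXj _ pth uk sk lp).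
Qed.

Fixpoint path_edges x p : set (set N) :=
  if p is y :: p' then [set x; y] |` path_edges y p' else set0.

Lemma path_edges_mem x p e z : path_edges x p e -> e z -> z \in x :: p.
Proof.
elim: p x => //= y p IH x [->|/IH h] => [[]->|/h]; rewrite !inE ?eqxx ?orbT //.
by move=> ->; rewrite orbT.
Qed.

Lemma finite_path_edges x p : finite_set (path_edges x p).
Proof. by elim: p x => //= y p IH x; rewrite finite_setU. Qed.

Lemma forest_path_edges x p : uniq (x :: p) -> forest (path_edges x p).
Proof.
elim: p x => [|y p IH] x; first by move=> _; apply: forest0.
rewrite cons_uniq => /andP[xyp uyp].
apply: (@forest_bridge _ [set x]) => //; first exact: IH.
  move=> a b /path_edges_mem ab ax; have ayp : a \in y :: p by apply: ab; left.
  by rewrite -ax ayp in xyp.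
by move=> /= yx; rewrite yx mem_head in xyp.
Qed.

Lemma path_edgesP (r : rel N) x p e : path r x p -> path_edges x p e ->
  exists a b, [/\ a \in belast x p, r a b & e = [set a; b]].
Proof.
elim: p x => //= y p IH x /andP[rxy yp] [->|/(IH _ yp)[a [b [ap rab eab]]]].
  by exists x, y; rewrite mem_head.
by exists a, b; rewrite inE ap orbT.
Qed.

Lemma path_path_edges x p S : path_edges x p `<=` S ->
  path (fun a b => [set a; b] \in S) x p.
Proof.
elim: p x => //= y p IH x h; rewrite IH ?andbT; last by move=> e he; apply: h; right.
by apply/mem_set/h; left.
Qed.

Local Open Scope card_scope.

Lemma finite_graphic_rank S : finite_set S ->
  exists r, graphic_rank S r.
Proof.
move=> /finite_setP[n Sn].
pose P k := `[< exists T, [/\ T `<=` S, forest T & T #= `I_k] >].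
have exP : exists k, P k.
  exists 0%N; apply/asboolP; exists set0; split=> //; first exact: forest0.
  by rewrite II0.
have leP k : P k -> (k <= n)%N.
  move=> /asboolP[T [TS _ Tk]]; rewrite -card_le_II -(card_le_eql Tk) -(card_le_eqr Sn).
  exact: subset_card_le.
case: (ex_maxnP exP leP) => r /asboolP[T hT] hr; exists r; split; first by exists T.
move=> T' T'S fT'; have /finite_setP[m T'm] : finite_set T'.
  by apply: sub_finite_set T'S _; apply/finite_setP; exists n.
rewrite (card_le_eql T'm) card_le_II; apply: hr; apply/asboolP.
by exists T'.
Qed.

Lemma graphic_rank_bridge S X i j r : edge_closed S X -> X i -> ~ X j ->
  graphic_rank S r -> graphic_rank ([set i; j] |` S) r.+1.
Proof.
move=> clX Xi nXj [[T [TS fT Tr]] maxT]; split.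
  exists ([set i; j] |` T); split; first exact: setUS.
    exact: forest_bridge fT (edge_closed_sub TS clX) Xi nXj.
  by apply: card_setU1 => // /TS /clX h; apply: nXj; apply: h.
move=> T' T'S fT'.
have [T'ij|nT'ij] := pselect (T' [set i; j]); last first.
  apply: (@card_le_trans _ _ _ `I_r); last by rewrite card_le_II.
  by apply: maxT => // e T'e; case: (T'S _ T'e) => // eij; rewrite eij in T'e.
have T'ijr : (T' `\ [set i; j]) #<= `I_r.
  apply: maxT; last by apply: forest_sub fT'; apply: subDsetl.
  by move=> e [T'e /= ne]; case: (T'S _ T'e).
have /finite_setP[m Tm] : finite_set (T' `\ [set i; j]).
  by apply: card_le_finite T'ijr _; apply: finite_II.
have := card_setU1 Tm (x := [set i; j]); rewrite setD1K // => /(_ (fun h => h.2 erefl)) Tm1.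
by rewrite (card_le_eql Tm1) card_le_II ltnS -card_le_II -(card_le_eql Tm).
Qed.

Lemma graphic_rank_forest S r : forest S -> S #= `I_r -> graphic_rank S r.
Proof.
move=> fS Sr; split; first by exists S; split.
by move=> T TS _; rewrite -(card_le_eqr Sr); apply: subset_card_le.
Qed.

(** The whole set is not a forest, so every forest in it misses an edge and has at most as many
    edges as [S]. *)
Lemma graphic_rank_circuit S e r : forest S -> ~ forest (e |` S) ->
  S #= `I_r -> graphic_rank (e |` S) r.
Proof.
move=> fS nf Sr; split; first by exists S; split=> // x; right.
have [Se|nSe] := pselect (S e).
  by case: nf; rewrite setUidr // => x ->.
have Sr1 := card_setU1 Sr nSe => T TS fT.
have [g [Sg nTg]] : exists g, (e |` S) g /\ ~ T g.
  apply: contrapT => /forallNP h; apply: nf; apply: forest_sub fT => g Sg.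
  by have /not_andP[//|/contrapT] := h g.
rewrite -(card_le_eqr (card_setD1 Sr1 Sg)); apply: subset_card_le => x Tx.
by split; [apply: TS|move=> /= xg; apply: nTg; rewrite -xg].
Qed.

End Forests.

(** * Potentials of gain graphs *)

Section Potentials.
Variables (N : choiceType) (adj : rel N).
Hypotheses (adj_irr : irreflexive adj) (adj_sym : symmetric adj).

(** The root is the canonical choice among the nodes joined to [v]; adjacent nodes have equivalent
    predicates, so [eq_xchoose] gives them the same root. *)
Lemma component_roots : exists root : N -> N,
  (forall v, exists2 p, path adj (root v) p & last (root v) p = v) /\
  (forall i j, adj i j -> root i = root j).
Proof.
pose C v u := `[< exists2 p, path adj u p & last u p = v >].
have exC v : exists u, C v u by exists v; apply/asboolP; exists [::].
exists (fun v => xchoose (exC v)); split.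
  by move=> v; have /asboolP := xchooseP (exC v).
have CS i j u : adj i j -> C i u -> C j u.
  move=> ij /asboolP[p up lp]; apply/asboolP; exists (rcons p j).
    by rewrite rcons_path up lp.
  by rewrite last_rcons.
move=> i j ij; apply: eq_xchoose => u; apply/idP/idP; first exact: CS.
by apply: CS; rewrite adj_sym.
Qed.

Lemma constant_on_path (T : Type) (r : N -> T) x p :
  (forall i j, adj i j -> r i = r j) -> path adj x p -> r x = r (last x p).
Proof.
by move=> h; elim: p x => //= y p IH x /andP[/h -> /IH].
Qed.

Variables (T : Type) (tau : N -> N -> T -> T).

(** [tau i j] is the action of the gain of a directed edge on an arbitrary type: below it acts once
    on scalars by multiplication and once on forms by addition. *)
Fixpoint transport x (p : seq N) (a : T) : T :=
  if p is y :: p' then transport y p' (tau x y a) else a.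

Lemma transport_cat x p q a :
  transport x (p ++ q) a = transport (last x p) q (transport x p a).
Proof. by elim: p x a => //= y p IH x a. Qed.

Hypothesis tauK : forall i j a, adj i j -> tau j i (tau i j a) = a.
Hypothesis tau_circuit : forall x p a, (1 < size p)%N -> uniq (x :: p) ->
  cycle adj (x :: p) -> transport x (rcons p x) a = a.

(** Induction on the length. A repeated node splits off a shorter closed walk, and what is left is
    shorter too. Without repetition the walk is empty, an edge and back, or a circuit. *)
Lemma transport_closed x p a :
  path adj x p -> last x p = x -> transport x p a = a.
Proof.
have [n] := ubnP (size p); elim: n x p a => // n IH x p a sp xp lp.
have [|nu] := boolP (uniq p).
  case: (lastP p) xp lp sp => // q y qy; rewrite last_rcons => yx; rewrite yx in qy *.
  rewrite rcons_uniq => _ /andP[xq uq].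
  case: q qy xq uq => [|z [|t q]] qy xq uq.
  - by move: qy; rewrite /= adj_irr.
  - by rewrite /= tauK //; move: qy => /= /andP[].
  - by apply: tau_circuit => //; rewrite cons_uniq xq.
have /(uniqPn x)[i [j [ij jp eij]]] := nu.
set z := nth x p i in eij.
have ip : (i < size p)%N by apply: ltn_trans jp.
pose p1 := take i.+1 p; pose p2 := take (j - i) (drop i.+1 p); pose p3 := drop j.+1 p.
have Dp : p = p1 ++ p2 ++ p3.
  rewrite -[LHS](cat_take_drop i.+1) -/p1; congr (_ ++ _).
  by rewrite -[LHS](cat_take_drop (j - i)) drop_drop /p3 addnS subnK // ltnW.
have l1 : last x p1 = z by rewrite /p1 (take_nth x) // last_rcons.
have l2 : last z p2 = z.
  have D : rcons (take (j - i.+1) (drop i.+1 p)) z = p2.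
    rewrite /p2 -(subnSK ij) (take_nth x) ?size_drop ?ltn_sub2r //.
      by rewrite nth_drop subnKC // -eij.
    exact: leq_ltn_trans ij jp.
  by rewrite -D last_rcons.
have s1 : size p1 = i.+1 by rewrite size_takel.
have s2 : size p2 = (j - i)%N.
  by rewrite size_takel // size_drop; rewrite -subSS leq_sub2r.
move: xp lp sp; rewrite Dp !cat_path !last_cat l1 l2 => /and3P[xp1 zp2 zp3] lp3.
rewrite !size_cat s1 s2 ltnS => sp.
rewrite !transport_cat l1 l2 [transport z p2 _](IH) //; last first.
  by apply: leq_trans sp; rewrite s2 addSn ltnS addnCA leq_addr.
rewrite -l1 -transport_cat; apply: IH; last by rewrite last_cat l1.
  apply: leq_trans sp; rewrite size_cat s1 ltn_add2l -[ltnLHS]add0n ltn_add2r.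
  by rewrite subn_gt0.
by rewrite cat_path xp1 l1.
Qed.

Lemma path_inverse x p : path adj x p -> exists q,
  [/\ path adj (last x p) q, last (last x p) q = x
    & forall a, transport (last x p) q (transport x p a) = a].
Proof.
elim: p x => [|y p IH] x /=; first by exists [::].
move=> /andP[xy /IH[q [yq lq tq]]]; exists (rcons q x); split.
- by rewrite rcons_path yq lq adj_sym.
- by rewrite last_rcons.
- by move=> a; rewrite -cats1 transport_cat tq lq /= tauK.
Qed.

(** The value at [v] is transported from the root along a chosen path; by [transport_closed] the
    choice of path does not matter. *)
Lemma exists_potential (root : N -> N) (a0 : T) :
    (forall v, exists2 p, path adj (root v) p & last (root v) p = v) ->
    (forall i j, adj i j -> root i = root j) ->
  exists k : N -> T, (forall v, k (root v) = a0) /\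
    (forall i j, adj i j -> k j = tau i j (k i)).
Proof.
move=> hroot rootE.
have /choice[P hP] v : exists p, path adj (root v) p /\ last (root v) p = v.
  by have [p rp lp] := hroot v; exists p.
exists (fun v => transport (root v) (P v) a0); split=> [v|i j ij].
  have [rP lP] := hP (root v).
  have e : root (root v) = root v.
    by have [rv lv] := hP v; rewrite (constant_on_path rootE rv) lv.
  by rewrite e in rP lP *; apply: transport_closed.
have [iP li] := hP i; have [jP lj] := hP j.
have [q [jq lq tq]] := path_inverse jP; rewrite lj in jq lq tq.
rewrite -[tau i j _]/(transport i [:: j] _) -[X in transport X [:: j]]li -transport_cat.
set r := P i ++ [:: j].
have rr : path adj (root i) r by rewrite /r cat_path iP li /= ij.
have lr : last (root i) r = j by rewrite /r last_cat.
(* Transport along [q] is inverted by [q'], so the two values at [j] may be compared after returning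
   to the root along [q]. *)
have [q' [_ _ tq']] := path_inverse jq.
rewrite -[LHS]tq' -[RHS]tq' tq; congr transport.
have := transport_closed (x := root i) (p := r ++ q) a0.
rewrite cat_path rr last_cat transport_cat lr => -> //.
by rewrite lq (rootE _ _ ij).
Qed.

End Potentials.

(** * Unique representability of graphic matroids *)

Section Representation.
Variables (F : unitRingType) (hF : skew_field F) (W : lmodType F) (H : set W).
Variables (N : choiceType) (E : set (set N)) (f : set N -> W -> F).
Hypotheses (sH : subspace H) (E_link : forall e, E e -> is_link e).
Hypothesis lf : forall e, lin (f e).

Let adj : rel N := fun i j => [set i; j] \in E.

(** The matroid content of a representation: an edge between different components of [S] is
    independent of [S], and (next hypothesis) the closing edge of a circuit depends on the rest. *)
Hypothesis bridge : forall S X i j, finite_set S -> S `<=` E ->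
  E [set i; j] -> edge_closed S X -> X i -> ~ X j ->
  exists w, [/\ H w, forall e, S e -> f e w = 0 & f [set i; j] w != 0].

Hypothesis circuit : forall x p, (1 < size p)%N -> uniq (x :: p) ->
  cycle adj (x :: p) -> forall w, H w ->
  (forall t, t \in belast x p -> f [set t; next (x :: p) t] w = 0) ->
  f [set last x p; x] w = 0.

Let adj_irr : irreflexive adj.
Proof.
move=> i; apply/negP => /set_mem/E_link[a [b [ab /set2_eq[[ia ib]|[ib ia]]]]].
  by apply: ab; rewrite -ia -ib.
by apply: ab; rewrite -ia -ib.
Qed.

Let adj_sym : symmetric adj.
Proof. by move=> i j; rewrite /adj setUC. Qed.

Lemma circuit_dependency x p :
    (1 < size p)%N -> uniq (x :: p) -> cycle adj (x :: p) ->
  exists a : N -> F, a (last x p) = 1 /\ forall w, H w ->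
    \sum_(t <- x :: p) f [set t; next (x :: p) t] w * a t = 0.
Proof.
move=> sp up cp.
have [] := lin_span hF (s := belast x p) (U := H)
  (g := fun t => f [set t; next (x :: p) t]) (f := f [set last x p; x]) => //.
- by move: up; rewrite lastI rcons_uniq => /andP[].
- exact: circuit.
move=> a ha; exists (fun t => if t == last x p then 1 else - a t).
rewrite eqxx; split=> // w Hw.
have := last_next up; set nx := next (x :: p) => nxl.
rewrite lastI -cats1 big_cat big_seq1 /= eqxx nxl mulr1 ha //.
rewrite -big_split big1_seq //= => t tp.
have /negbTE -> : t != last x p.
  by apply: contraTneq tp => ->; move: up; rewrite lastI rcons_uniq => /andP[].
by rewrite mulrN addNr.
Qed.

(* On the points where a finite set of edges avoiding w vanishes, the forms of
   any two edges at w are proportional in at most one way; this is what makes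
   the rescaling canonical. *)
Definition local_ratio (w u v : N) (b : F) : Prop :=
  exists S, [/\ finite_set S, S `<=` E, forall e, S e -> ~ e w &
    forall x, H x -> (forall e, S e -> f e x = 0) ->
      f [set w; u] x * b = f [set w; v] x].

(** No edge of [S] meets [w], so the singleton of [w] is closed under [S] and [bridge] applies. *)
Lemma star_nonzero S w u : finite_set S -> S `<=` E ->
    (forall e, S e -> ~ e w) -> adj w u ->
  exists x, [/\ H x, forall e, S e -> f e x = 0 & f [set w; u] x != 0].
Proof.
move=> fS SE Sw wu; apply: (bridge (X := [set w])) => //; first exact: set_mem.
  move=> a b /Sw h /= aw; case: h; by left.
by move=> /= uw; rewrite uw adj_irr in wu.
Qed.

Lemma local_ratio_trans w u v t b c :
  local_ratio w u v b -> local_ratio w v t c -> local_ratio w u t (b * c).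
Proof.
move=> [S [fS SE Sw hS]] [S' [fS' SE' Sw' hS']]; exists (S `|` S'); split.
- by rewrite finite_setU.
- by move=> e [/SE|/SE'].
- by move=> e [/Sw|/Sw'].
- move=> x Hx hx; rewrite mulrA hS // ?hS' // => e he; apply: hx; by [left|right].
Qed.

Lemma local_ratio_unique w u v b c : adj w u ->
  local_ratio w u v b -> local_ratio w u v c -> b = c.
Proof.
move=> wu [S [fS SE Sw hS]] [S' [fS' SE' Sw' hS']].
have [||e|x [Hx hx ux]] := @star_nonzero (S `|` S') w u _ _ _ wu.
- by rewrite finite_setU.
- by move=> e [/SE|/SE'].
- by move=> [/Sw|/Sw'].
have := etrans (hS x Hx _) (esym (hS' x Hx _)) => h.
have {}h : f [set w; u] x * b = f [set w; u] x * c.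
  by apply: h => e he; apply: hx; [left|right].
by have /hF ux' := ux; rewrite -[LHS](mulKr ux') h mulKr.
Qed.

Lemma local_ratio_neq0 w u v b : adj w v -> local_ratio w u v b -> b != 0.
Proof.
move=> wv [S [fS SE Sw hS]].
have [x [Hx hx vx]] := star_nonzero fS SE Sw wv.
by apply: contraNneq vx => b0; rewrite -hS // b0 mulr0.
Qed.

Lemma local_ratio_refl w u : local_ratio w u u 1.
Proof. by exists set0; split=> // x _ _; rewrite mulr1. Qed.

Lemma local_ratio_sym w u v b : adj w v ->
  local_ratio w u v b -> local_ratio w v u b^-1.
Proof.
move=> wv hb; have ub := hF (local_ratio_neq0 wv hb).
have [S [fS SE Sw hS]] := hb; exists S; split=> // x Hx hx.
by rewrite -hS // mulrK.
Qed.

(** Having a ratio is an equivalence relation on the edges at [w]. Each class gets a representative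
    through [r], and [l w u] is the ratio from [u] to it. *)
Lemma local_scaling : exists l : N -> N -> F,
  (forall w u, adj w u -> l w u != 0) /\
  (forall w u v b, adj w u -> adj w v -> local_ratio w u v b ->
     l w u = b * l w v).
Proof.
pose C w u t := `[< adj w t /\ exists b, local_ratio w u t b >].
have /choice[r hr] (w : N) : exists r : N -> N,
    (forall u, adj w u -> adj w (r u) /\ exists b, local_ratio w u (r u) b) /\
    (forall u v b, adj w u -> adj w v -> local_ratio w u v b -> r u = r v).
  (* The implication keeps the predicate satisfiable when [u] is not adjacent to [w], as [xchoose]
     demands. *)
  have exC u : exists t, adj w u ==> C w u t.
    exists u; apply/implyP => wu; apply/asboolP; split=> //.
    by exists 1; apply: local_ratio_refl.
  exists (fun u => xchoose (exC u)); split.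
    by move=> u wu; have /implyP/(_ wu)/asboolP := xchooseP (exC u).
  move=> u v b wu wv hb; apply: eq_xchoose => t; rewrite wu wv /=.
  apply: asbool_equiv_eq; split=> -[wt [c hc]]; split=> //.
    by exists (b^-1 * c); apply: local_ratio_trans (local_ratio_sym wv hb) hc.
  by exists (b * c); apply: local_ratio_trans hb hc.
have /choice[l hl] (wu : N * N) : exists b : F, adj wu.1 wu.2 ->
    local_ratio wu.1 wu.2 (r wu.1 wu.2) b.
  have [wu'|] := boolP (adj wu.1 wu.2); last by exists 0.
  by have [_ [b hb]] := (hr wu.1).1 wu.2 wu'; exists b.
exists (fun w u => l (w, u)); split=> [w u wu|w u v b wu wv hb].
  by apply: local_ratio_neq0 (hl (w, u) wu); case: ((hr w).1 u wu).
apply: (local_ratio_unique wu (hl (w, u) wu)) => /=.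
rewrite ((hr w).2 _ _ _ wu wv hb); exact: local_ratio_trans hb (hl (w, v) wv).
Qed.

(** Where the circuit edges avoiding the node [nx y] vanish, only the two edges at that node survive
    in the dependency; their coefficients give the ratio or vanish together. *)
Lemma circuit_local x p (a : N -> F) (y : N) :
    let nx := next (x :: p) in
    (1 < size p)%N -> uniq (x :: p) -> cycle adj (x :: p) ->
    (forall w, H w -> \sum_(t <- x :: p) f [set t; nx t] w * a t = 0) ->
    y \in x :: p ->
  a y = 0 /\ a (nx y) = 0 \/
  local_ratio (nx y) (nx (nx y)) y (- a (nx y) * (a y)^-1).
Proof.
set c := x :: p => nx sp up cp ha yc.
have zc : nx y \in c by rewrite mem_next.
have ynz : y != nx y.
  by apply: contraTneq (next_cycle cp yc) => e; rewrite -[next c y]e adj_irr.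
pose S := [set e | exists t, [/\ t \in c, t != y, t != nx y & e = [set t; nx t]]].
have fS : finite_set S.
  apply: (@sub_finite_set _ _ ((fun t => [set t; nx t]) @` [set` c])).
    by move=> e [t [tc _ _ ->]]; exists t.
  by apply: finite_image; apply: finite_seq.
have SE : S `<=` E by move=> e [t [tc _ _ ->]]; apply/set_mem; apply: next_cycle cp tc.
have Sz e : S e -> ~ e (nx y).
  move=> [t [tc ty tz ->]] [/= zt|/= /(can_inj (prev_next up)) yt].
    by rewrite zt eqxx in tz.
  by rewrite yt eqxx in ty.
have key w : H w -> (forall e, S e -> f e w = 0) ->
    f [set nx y; y] w * a y + f [set nx y; nx (nx y)] w * a (nx y) = 0.
  move=> Hw hw; rewrite -[RHS](ha w Hw) (bigD1_seq y) //= setUC; congr (_ + _).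
  rewrite big_mkcond (bigD1_seq (nx y)) //= eq_sym ynz big1_seq ?addr0 //.
  move=> t /= /andP[tz tc]; case: ifP => // ty.
  by rewrite hw ?mul0r //; exists t.
have zy : adj (nx y) y by rewrite adj_sym; apply: next_cycle cp yc.
have zz : adj (nx y) (nx (nx y)) by apply: next_cycle cp zc.
have [ay|/hF uy] := eqVneq (a y) 0; [left|right].
  split=> //; have [w [Hw hw nz]] := star_nonzero fS SE Sz zz.
  have /eqP := key w Hw hw; rewrite ay mulr0 add0r skew_mulf_eq0 // (negbTE nz).
  by move=> /eqP.
exists S; split=> // w Hw hw; have /eqP := key w Hw hw.
rewrite addrC addr_eq0 => /eqP h.
by rewrite mulNr mulrN mulrA h mulNr opprK mulrK.
Qed.

Lemma path_ind (r : rel N) (P : N -> Prop) x p : path r x p -> P x ->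
  (forall a b, a \in x :: p -> r a b -> P a -> P b) ->
  forall t, t \in x :: p -> P t.
Proof.
elim: p x => [|y p IH] x /=; first by move=> _ Px _ t; rewrite inE => /eqP ->.
move=> /andP[xy yp] Px step t; rewrite inE => /predU1P[->//|].
apply: IH => //; first by apply: step xy Px; rewrite mem_head.
by move=> a b ap; apply: step; rewrite inE ap orbT.
Qed.

Lemma transport_path (T : Type) (tau : N -> N -> T -> T) (r : rel N) x p
    (k : N -> T) : path r x p ->
    (forall a b, a \in belast x p -> r a b -> k b = tau a b (k a)) ->
  transport tau x p (k x) = k (last x p).
Proof.
elim: p x => //= y p IH x /andP[xy yp] step.
rewrite -(step x y) ?mem_head // IH // => a b ap.
by apply: step; rewrite inE ap orbT.
Qed.

(* The scalars [l] make the forms of the edges at each node compatible; [k]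
   reconciles the two scalars that an edge receives from its ends. *)
Lemma global_scaling : exists m : N -> N -> F,
  [/\ forall i j, adj i j -> m i j != 0,
      forall i j, adj i j -> m j i = - m i j
    & forall x p, (1 < size p)%N -> uniq (x :: p) -> cycle adj (x :: p) ->
        forall w, H w ->
        \sum_(t <- x :: p) f [set t; next (x :: p) t] w * m t (next (x :: p) t) = 0].
Proof.
have [l [l0 hl]] := local_scaling.
(* Forced by antisymmetry: with [m i j = l i j * k i], the equation [m j i = - m i j] reads
   [k j = tau i j (k i)]. *)
pose tau i j (k : F) := - (l j i)^-1 * (l i j * k).
have tauM i j k s : tau i j (k * s) = tau i j k * s by rewrite /tau !mulrA.
have tau0 i j k : adj i j -> k != 0 -> tau i j k != 0.
  move=> ij k0; have ji : adj j i by rewrite adj_sym.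
  rewrite /tau !skew_mulf_eq0 // oppr_eq0 !negb_or l0 // k0 !andbT.
  by rewrite -skew_unit // unitrV hF // l0.
have tauK i j k : adj i j -> tau j i (tau i j k) = k.
  move=> ij; have ji : adj j i by rewrite adj_sym.
  by rewrite /tau !mulNr !mulrN opprK !mulrA mulrK ?hF ?l0 // mulVr ?mul1r ?hF ?l0.
(* On a single circuit the coefficients of its dependency, divided by [l], satisfy the recursion of
   [tau]. *)
have kappa x p : (1 < size p)%N -> uniq (x :: p) -> cycle adj (x :: p) ->
    exists k : N -> F, [/\ k x != 0,
      forall w, H w -> \sum_(t <- x :: p) f [set t; next (x :: p) t] w *
                        (l t (next (x :: p) t) * k t) = 0
    & forall y, y \in x :: p -> k (next (x :: p) y) = tau y (next (x :: p) y) (k y)].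
  move=> sp up cp; have [a [alast ha]] := circuit_dependency sp up cp.
  pose nx := next (x :: p); have nxP y := next_cycle cp (x := y).
  have k_step y : y \in x :: p -> (l (nx y) (nx (nx y)))^-1 * a (nx y) =
      tau y (nx y) ((l y (nx y))^-1 * a y).
    move=> yc; have zc : nx y \in x :: p by rewrite mem_next.
    have yz := nxP _ yc; have zy : adj (nx y) y by rewrite adj_sym.
    have zz : adj (nx y) (nx (nx y)) by apply: nxP.
    have uzz := hF (l0 _ _ zz); have uyz := hF (l0 _ _ yz); have uzy := hF (l0 _ _ zy).
    rewrite /tau mulVKr //.
    have [[ay az]|h] := circuit_local sp up cp ha yc; first by rewrite ay az !mulr0.
    have b0 := local_ratio_neq0 zy h; have := hl _ _ _ _ zz zy h.
    have ua : a y \is a GRing.unit.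
      by apply: hF; apply: contraNneq b0 => ->; rewrite invr0 mulr0.
    move=> e; have -> : a (nx y) = - l (nx y) (nx (nx y)) * (l (nx y) y)^-1 * a y.
      by rewrite e !mulNr opprK mulrK // mulrVK.
    by rewrite !mulNr mulrN !mulrA mulVr // mul1r.
  exists (fun t => (l t (nx t))^-1 * a t); split=> //.
  - have lc : last x p \in x :: p by apply: mem_last.
    have := k_step _ lc; rewrite /nx last_next // -/nx => ->.
    apply: tau0; first by have := nxP _ lc; rewrite last_next.
    rewrite alast mulr1 -skew_unit // unitrV hF // l0 //.
    by have := nxP _ lc; rewrite last_next.
  - move=> w Hw; rewrite -[RHS](ha w Hw) !big_seq; apply: eq_bigr => t tc.
    by rewrite mulVKr // hF // l0 //; apply: nxP.
(* Transport commutes with right multiplication, so it is the identity around a circuit once it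
   fixes the one nonzero value [k x]. *)
have tau_circ x p a : (1 < size p)%N -> uniq (x :: p) -> cycle adj (x :: p) ->
    transport tau x (rcons p x) a = a.
  move=> sp up cp; have [k [kx0 _ kstep]] := kappa x p sp up cp.
  have tM q y (b s : F) : transport tau y q (b * s) = transport tau y q b * s.
    by elim: q y b => //= z q IH y b; rewrite tauM IH.
  have ukx := hF kx0.
  rewrite -[a](mulVKr ukx) tM; congr (_ * _).
  have /= cn := cycle_next up.
  rewrite (transport_path (k := k) cn) ?last_rcons // => y z.
  by rewrite belast_rcons => yc /eqP <-; apply: kstep.
have [root [hroot rootE]] := component_roots adj_sym.
have [k [k_root k_step]] := exists_potential adj_irr adj_sym tauK tau_circ 1 hroot rootE.
have k0 v : k v != 0.
  have [p rp <-] := hroot v.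
  apply: (path_ind (P := fun v => k v != 0) rp) (mem_last _ _); first by rewrite k_root oner_eq0.
  by move=> a b _ ab ka; rewrite (k_step _ _ ab) tau0.
exists (fun i j => l i j * k i); split.
- by move=> i j ij; rewrite skew_mulf_eq0 // negb_or l0 // k0.
- move=> i j ij; rewrite (k_step _ _ ij) /tau mulNr mulrN mulVKr //.
  by apply/hF/l0; rewrite adj_sym.
- move=> x p sp up cp w Hw; have [k' [k'x hk' k'step]] := kappa x p sp up cp.
  have ukx := hF (k0 x).
  (* The global [k] and the [k'] of this circuit satisfy the same recursion, so they differ along it
     by the constant right factor [s], which cancels from the dependency. *)
  pose s := (k x)^-1 * k' x.
  have us : s \is a GRing.unit by rewrite unitrMl ?unitrV // hF.
  have k'E t : t \in x :: p -> k' t = k t * s.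
    apply: (path_ind (P := fun t => k' t = k t * s) (path_next up)).
      by rewrite /s mulVKr.
    move=> a b ac /eqP <- e.
    by rewrite k'step // e tauM -k_step //; apply: next_cycle cp ac.
  apply/eqP; rewrite -[_ == 0]orbF -[in false](negbTE (_ : s != 0)) -?skew_unit //.
  rewrite -skew_mulf_eq0 // mulr_suml -[X in _ == X](hk' w Hw); apply/eqP.
  by rewrite !big_seq; apply: eq_bigr => t tc; rewrite k'E // !mulrA.
Qed.

End Representation.

(** * Coordinates of the largest possible rank *)

Section Matching.
Variables (F : unitRingType) (hF : skew_field F) (W : lmodType F).
Variables (N : choiceType) (K : set W) (M : set N).

Definition other_vectors (R : set (W * N)) v : set W :=
  [set x | exists2 u, u <> v & R (x, u)].

(** Each vector avoids the span of the vectors matched to other elements, so distinct elements have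
    distinct, independent partners. *)
Definition independent_matching (R : set (W * N)) : Prop :=
  (forall b v, R (b, v) -> [/\ K b, M v & ~ lspan (other_vectors R v) b]) /\
  (forall b b' v, R (b, v) -> R (b', v) -> b = b').

Lemma other_vectorsS R R' v : R `<=` R' ->
  other_vectors R v `<=` other_vectors R' v.
Proof. by move=> RR' x [u uv /RR']; exists u. Qed.

Lemma chain_matching (C : set (set (W * N))) :
  C `<=` independent_matching -> total_on C subset ->
  independent_matching (\bigcup_(R in C) R).
Proof.
move=> CI Ctot; split=> [b v [R CR Rbv]|b b' v [R CR Rb] [R' CR' Rb']]; last first.
  by have [RR'|R'R] := Ctot R R' CR CR';
    [apply: (CI R' CR').2 Rb'; apply: RR'|apply: (CI R CR).2 Rb _; apply: R'R].
have [Kb Mv _] := (CI R CR).1 _ _ Rbv; split=> // sb.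
(* Of two members of the chain one contains the other, so [Q] is a subspace; hence a dependency over
   the union already holds in one member. *)
pose Q := [set x | exists2 R', C R' & lspan (other_vectors R' v) x].
have [R1 CR1 sR1] : Q b.
  apply: sb; last by move=> x [u uv [R1 CR1 R1x]]; exists R1 => //; apply: sub_lspan; exists u.
  split; first by exists R => //; case: (lspan_subspace (other_vectors R v)).
  move=> a x y [R1 CR1 hx] [R2 CR2 hy].
  have [R12|R21] := Ctot R1 R2 CR1 CR2; [exists R2|exists R1] => //;
    apply: (lspan_subspace _).2 => //.
    exact: lspan_mono (other_vectorsS R12) _ hx.
  exact: lspan_mono (other_vectorsS R21) _ hy.
have [RR1|R1R] := Ctot R R1 CR CR1.
  by have [_ _] := (CI R1 CR1).1 _ _ (RR1 _ Rbv); apply.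
have [_ _] := (CI R CR).1 _ _ Rbv; apply.
exact: lspan_mono (other_vectorsS R1R) _ sR1.
Qed.

(** If an old vector became dependent through [k], the coefficient of [k] would be nonzero, and an
    exchange would put [k] into the old span. *)
Lemma extend_matching R k v0 : independent_matching R -> K k -> M v0 ->
  (forall b, ~ R (b, v0)) -> ~ lspan [set x | exists u, R (x, u)] k ->
  independent_matching ((k, v0) |` R).
Proof.
move=> [indR funR] Kk Mv0 nv0 nk; split.
  move=> b v [[-> ->]|Rbv].
    split=> // sk; apply: nk; apply: (lspan_mono _ sk) => x [u uv0 [[_ /uv0//]|Rx]].
    by exists u.
  have [Kb Mv nb] := indR _ _ Rbv; split=> // sb.
  have : lspan (k |` other_vectors R v) b.
    by apply: (lspan_mono _ sb) => x [u uv [[-> _]|Rx]]; [left|right; exists u].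
  move=> /lspan_setU1[a ha].
  have a0 : a != 0 by apply: contra_notN nb => /eqP a0; rewrite a0 scale0r subr0 in ha.
  apply: nk; apply: (subspaceZ_inv hF (@lspan_subspace _ _ _) a0).
  have -> : a *: k = b - (b - a *: k) by rewrite subKr.
  apply: (subspaceB (@lspan_subspace _ _ _)).
    by apply: sub_lspan; exists v.
  by apply: (lspan_mono _ ha) => x [u _ Rx]; exists u.
move=> b b' v [[bk vv0]|Rb] [[bk' vv0']|Rb'].
- by rewrite bk bk'.
- by rewrite vv0 in Rb'; case: (nv0 b').
- by rewrite vv0' in Rb; case: (nv0 b).
- exact: funR Rb Rb'.
Qed.

Lemma matching_functionals : exists z : N -> W -> F, (forall v, lin (z v)) /\
  ((forall w, K w -> (forall v, M v -> z v w = 0) -> w = 0) \/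
   (exists b : N -> W, forall v, M v -> K (b v) /\
      forall u, M u -> z u (b v) = (u == v)%:R)).
Proof.
have [R [[indR funR] maxR]] := Zorn_bigcup chain_matching.
have /choice[z hz] (v : N) : exists z : W -> F, lin z /\
    forall b, R (b, v) -> z b = 1 /\ forall x, lspan (other_vectors R v) x -> z x = 0.
  have [[b Rb]|/forallNP nb] := pselect (exists b, R (b, v)); last first.
    by exists (fun=> 0); split=> [|b /nb//]; apply: lin_cst0.
  have [_ _ nsb] := indR _ _ Rb.
  have [z [lz zb z0]] := separating_functional hF (@lspan_subspace _ _ _) nsb.
  by exists z; split=> // b' Rb'; rewrite (funR _ _ _ Rb' Rb).
have lz v : lin (z v) by case: (hz v).
exists z; split=> //.
have [allM|] := pselect (forall v, M v -> exists b, R (b, v)).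
  right; have /choice[b hb] v : exists b, M v -> R (b, v).
    have [/allM[b Rb]|nM] := pselect (M v); first by exists b.
    by exists 0 => /nM.
  exists b => v Mv; have [Kb _ _] := indR _ _ (hb v Mv); split=> // u Mu.
  have [_ /(_ _ (hb u Mu))[zu zs]] := hz u.
  have [->|uv] := eqVneq u v; first by case: (hz v) => _ /(_ _ (hb v Mv))[].
  by apply: zs; apply: sub_lspan; exists v; [move=> vu; rewrite vu eqxx in uv|apply: hb].
move=> /existsNP[v0 /not_implyP[Mv0 /forallNP nv0]]; left => w Kw zw.
have spanK : lspan [set x | exists u, R (x, u)] w.
  apply: contrapT => nw.
  have : R `<` (w, v0) |` R.
    by split=> [x|]; [right|move=> /(_ (w, v0) (or_introl erefl)) /nv0].
  by move=> /maxR; apply; apply: extend_matching.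
(* [w] is in the span of finitely many matched vectors. Its coefficient at each is the value of the
   dual functional, zero by assumption, so the list can be emptied. *)
pose L (s : seq N) := [set x | exists2 v, v \in s & R (x, v)].
have [s sw] : exists s, lspan (L s) w.
  apply: (spanK [set x | exists s, lspan (L s) x]); last first.
    move=> x [v Rx]; exists [:: v]; apply: sub_lspan; exists v => //.
    by rewrite mem_head.
  split; first by exists [::]; case: (lspan_subspace (L [::])).
  move=> a x y [s hs] [t ht]; exists (s ++ t).
  apply: (lspan_subspace _).2.
    by apply: (lspan_mono _ hs) => u [v vs Ru]; exists v => //; rewrite mem_cat vs.
  by apply: (lspan_mono _ ht) => u [v vt Ru]; exists v => //; rewrite mem_cat vt orbT.
elim: s sw => [|v s IH] sw.
  by apply: lspan0; apply: (lspan_mono _ sw) => x [].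
have [vs|nvs] := boolP (v \in s).
  by apply: IH; apply: (lspan_mono _ sw) => x [u]; rewrite inE => /predU1P[->|us] Rx; [exists v|exists u].
have [[b Rb]|/forallNP nb] := pselect (exists b, R (b, v)); last first.
  apply: IH; apply: (lspan_mono _ sw) => x [u]; rewrite inE => /predU1P[->|us] Rx; last by exists u.
  by case: (nb x).
have [_ Mv _] := indR _ _ Rb; have [_ /(_ _ Rb)[zb zs]] := hz v.
have : lspan (b |` L s) w.
  apply: (lspan_mono _ sw) => x [u]; rewrite inE => /predU1P[->|us] Rx; last by right; exists u.
  by left; apply: funR Rx Rb.
move=> /lspan_setU1[a ha]; apply: IH.
have : z v (w - a *: b) = 0.
  apply: zs; apply: (lspan_mono _ ha) => x [u us Rx]; exists u => // uv.
  by rewrite uv (negbTE nvs) in us.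
rewrite linB // linZ // zw // zb mulr1 sub0r => /eqP; rewrite oppr_eq0 => /eqP a0.
by rewrite a0 scale0r subr0 in ha.
Qed.

End Matching.

(** * Synthetic arrangements have coordinates *)

Section SyntheticRank.
Variables (F : unitRingType) (hF : skew_field F) (W : lmodType F) (H : set W).
Variables (N : choiceType) (E : set (set N)) (beta : set N -> set W).
Hypotheses (sH : subspace H) (s_beta : forall e, E e -> subspace (beta e)).
Hypothesis beta_rank : forall S r, S `<=` E -> finite_set S ->
  graphic_rank S r -> codim H (H `&` \bigcap_(e in S) beta e) r.

Let flat_subspace S : S `<=` E -> subspace (H `&` \bigcap_(e in S) beta e).
Proof.
by move=> SE; apply: subspaceI => //; apply: subspace_bigcap => e /SE /s_beta.
Qed.

(** Otherwise adding the edge would leave the flat unchanged although the rank rises. *)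
Lemma synthetic_bridge S X i j : finite_set S -> S `<=` E -> E [set i; j] ->
    edge_closed S X -> X i -> ~ X j ->
  exists w, [/\ H w, forall e, S e -> beta e w & ~ beta [set i; j] w].
Proof.
move=> fS SE Eij clX Xi nXj; have [r rS] := finite_graphic_rank fS.
have rS1 := graphic_rank_bridge clX Xi nXj rS.
have S1E : [set i; j] |` S `<=` E by move=> e [->|/SE].
apply: contrapT => /forallNP h.
have eqU : H `&` \bigcap_(e in [set i; j] |` S) beta e = H `&` \bigcap_(e in S) beta e.
  apply/seteqP; split=> w [Hw hw]; split=> // e.
    by move=> Se; apply: hw; right.
  case=> [->|/hw//]; have /not_and3P[//|nS|/contrapT//] := h w.
  by case: nS.
have := beta_rank S1E _ rS1; rewrite eqU finite_setU => /(_ (conj (finite_set1 _) fS)) c1.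
have := codim_unique hF sH (flat_subspace SE) (beta_rank SE fS rS) c1.
by move=> /n_Sn.
Qed.

(** The path and the full circuit have the same rank, so their nested flats, of equal codimension,
    coincide. *)
Lemma synthetic_circuit x p : (1 < size p)%N -> uniq (x :: p) ->
    cycle (fun i j => [set i; j] \in E) (x :: p) -> forall w, H w ->
    (forall t, t \in belast x p -> beta [set t; next (x :: p) t] w) ->
  beta [set last x p; x] w.
Proof.
move=> sp up cp w Hw hw; set e := [set last x p; x].
pose S := path_edges x p.
have Sw g : S g -> beta g w.
  by move=> /(path_edgesP (path_next up))[a [b [ap /eqP <- ->]]]; apply: hw.
have SE : S `<=` E.
  move=> g; move: cp; rewrite /= rcons_path => /andP[xp _].
  by move=> /(path_edgesP xp)[a [b [_ /set_mem ab ->]]].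
have Ee : E e.
  by move: cp; rewrite /= rcons_path => /andP[_ /set_mem].
have eSE : e |` S `<=` E by move=> g [->|/SE].
have fS : finite_set S by apply: finite_path_edges.
have forS : forest S by apply: forest_path_edges.
have nfor : ~ forest (e |` S).
  move=> /(_ (x :: p) sp up) /negP; apply; rewrite /= rcons_path.
  rewrite path_path_edges; last by move=> g; right.
  by apply/mem_set; left.
have [r Sr] := (finite_setP S).1 fS.
have c0 := beta_rank SE fS (graphic_rank_forest forS Sr).
have feS : finite_set (e |` S) by rewrite finite_setU.
have c1 := beta_rank eSE feS (graphic_rank_circuit forS nfor Sr).
have [|_ h] := codim_eq hF sH (flat_subspace SE) (flat_subspace eSE) c0 c1 _ (conj Hw Sw).
  by move=> v [Hv hv]; split=> // g Sg; apply: hv; right.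
by apply: h; left.
Qed.

End SyntheticRank.

(** Induction on the list. If the new edge joins two components of the earlier ones, a multiple of a
    bridge vector corrects its difference and disturbs no other; if not, its difference is already
    right. *)
Lemma interpolation (F : unitRingType) (hF : skew_field F) (W : lmodType F)
    (H : set W) (N : choiceType) (E : set (set N)) (y : N -> W -> F)
    (L : seq (N * N)) (q : N -> F) :
    subspace H -> (forall v, lin (y v)) ->
    (forall S X i j, finite_set S -> S `<=` E -> E [set i; j] ->
       edge_closed S X -> X i -> ~ X j ->
       exists w, [/\ H w, forall a b, S [set a; b] -> y a w = y b w
                   & y i w <> y j w]) ->
    (forall ij, ij \in L -> E [set ij.1; ij.2]) ->
  exists w, H w /\ forall ij, ij \in L ->
    y ij.2 w - y ij.1 w = q ij.2 - q ij.1.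
Proof.
move=> sH ly bridge; elim: L => [_|[i j] L IH LE]; first by exists 0; split=> //; case: sH.
have LE' ij : ij \in L -> E [set ij.1; ij.2].
  by move=> ijL; apply: LE; rewrite inE ijL orbT.
have [w [Hw hw]] := IH LE'.
have Eij : E [set i; j] by apply: (LE (i, j)); rewrite mem_head.
pose S := [set e | exists2 ab, ab \in L & e = [set ab.1; ab.2]].
have fS : finite_set S.
  apply: (@sub_finite_set _ _ ((fun ab => [set ab.1; ab.2]) @` [set` L])).
    by move=> e [ab abL ->]; exists ab.
  by apply: finite_image; apply: finite_seq.
have SE : S `<=` E by move=> e [ab /LE' ? ->].
have [[X [clX Xi nXj]]|noX] := pselect (exists X, [/\ edge_closed S X, X i & ~ X j]).
  have [w' [Hw' hw' nij]] := bridge S X i j fS SE Eij clX Xi nXj.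
  have uc : y j w' - y i w' \is a GRing.unit.
    by apply: hF; rewrite subr_eq0; apply/eqP => /esym.
  pose c := (q j - q i - (y j w - y i w)) / (y j w' - y i w').
  exists (c *: w' + w); split; first by case: sH => _; apply.
  move=> ab; rewrite !ly opprD addrACA -mulrBr inE => /predU1P[->|abL] /=.
    by rewrite /c mulrVK // subrK.
  by rewrite hw // (hw' ab.1 ab.2) ?subrr ?mulr0 ?add0r //; exists ab.
exists w; split=> // ab; rewrite inE => /predU1P[->|/hw//] /=.
(* A level set of [y - q], closed under the earlier edges; by [noX] it cannot separate [j] from
   [i]. *)
pose X := [set v | y v w - q v = y i w - q i].
have : X j.
  apply: contrapT => nXj; apply: noX; exists X; split=> // a b [ij' /hw].
  move=> /eqP; rewrite subr_eq => /eqP h.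
  have h' : y ij'.2 w - q ij'.2 = y ij'.1 w - q ij'.1.
    by rewrite h addrC -!addrA addKr addrC.
  by move=> /set2_eq[[-> ->]|[-> ->]]; rewrite /X /= h'.
move=> /eqP; rewrite subr_eq => /eqP ->.
by rewrite addrC -!addrA addKr addrC.
Qed.

Lemma linear_homog (F : unitRingType) (W : lmodType F) (N : Type)
    (y : N -> W -> F) (t : W -> F) : (forall v, lin (y v)) -> lin t ->
  exists c : {linear W -> homog F N}, forall w, c w = (fun v => y v w, t w).
Proof.
move=> ly lt; pose c w : homog F N := (fun v => y v w, t w).
have lc : linear c.
  move=> a u v; rewrite /c lt; congr pair; apply/funext => x.
  by rewrite ly.
pose h := GRing.isLinear.Build F W (homog F N) *:%R c lc.
by exists (HB.pack_for {linear W -> homog F N} c h).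
Qed.

(** If [theta] vanished on [h], it would be a nonzero multiple of the form of [h], and [h] would be
    the ideal hyperplane. *)
Lemma affine_hyperplane_point (F : unitRingType) (hF : skew_field F)
    (G : affine_geometry F) (h : set (proj G)) (theta : proj G -> F) w0 :
    affine_hyperplane G h -> lin theta -> theta w0 = 1 ->
    (forall w, ideal G w <-> theta w = 0) ->
  exists2 w, h w & theta w = 1.
Proof.
move=> [hh hG] lt tw0 tH.
have [phi [b [lphi phib phiP]]] := hyperplane_functional hF hh.
have [[w [hw tw]]|/forallNP none] := pselect (exists w, h w /\ theta w <> 0).
  have /hF ut : theta w != 0 by apply/eqP.
  exists ((theta w)^-1 *: w); first by apply: subspaceZ hw; case: hh.
  by rewrite linZ // mulVr.
have {}none w : h w -> theta w = 0.
  by move=> hw; have /not_andP[//|/contrapT] := none w.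
case: hG; apply/seteqP; split=> [w /none /tH//|w /tH tw].
have [||a ha] := lin_factor hF (U := setT) _ lt lphi; first by [].
  by move=> v _ pv; apply/none/phiP.
apply/phiP/eqP; have := ha w I; rewrite tw => /esym/eqP.
rewrite skew_mulf_eq0 // => /orP[//|/eqP a0].
by have /eqP := ha w0 I; rewrite tw0 a0 mulr0 oner_eq0.
Qed.

Lemma synthetic_coordinates (F : unitRingType) (hF : skew_field F)
    (G : affine_geometry F) (I : Type) (A : I -> set (proj G))
    (N : choiceType) (Delta : simple_graph N) :
    synthetic_affinographic_with G A Delta ->
  exists (c : {linear proj G -> homog F N}) (Phi : gain_graph F N I),
    [/\ affine_coordinates G c, simplification_is Phi Delta
      & forall e : I, A e = affinographic c Phi e].
Proof.
move=> [hA [beta [[bfun binj bsurj] brank]]].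
pose W := proj G; pose H : set W := ideal G; pose E := edges Delta.
have sH : subspace H by case: (ideal_hyperplane G).
have [theta [w0 [lt tw0 tH]]] := hyperplane_functional hF (ideal_hyperplane G).
have /choice[we hwe] k : exists w, A k w /\ theta w = 1.
  by have [w ? ?] := affine_hyperplane_point hF (hA k) lt tw0 tH; exists w.
have /choice[en hen] k : exists e, E e /\ beta e = ideal_part G (A k).
  by have [|e Ee be] := bsurj (ideal_part G (A k)); [exists k|exists e].
have sA k : subspace (A k) by case: (hA k) => -[].
have betaE e : E e -> exists k, beta e = A k `&` H.
  by move=> Ee; have [k _ <-] := bfun e Ee; exists k.
have s_beta e : E e -> subspace (beta e).
  by move=> /betaE[k ->]; apply: subspaceI.
(* Projection onto [H] along [w0]; a form composed with it is determined by its restriction to [H]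
   and vanishes at [w0]. *)
pose pi w := w - theta w *: w0.
have Hpi w : H (pi w) by apply/tH; rewrite /pi linB // linZ // tw0 mulr1 subrr.
have piH w : H w -> pi w = w by move=> /tH tw; rewrite /pi tw scale0r subr0.
have piZD a u v : pi (a *: u + v) = a *: pi u + pi v.
  by rewrite /pi lt scalerDl opprD addrACA scalerBr scalerA.
have piw0 : pi w0 = 0 by rewrite /pi tw0 scale1r subrr.
have /choice[f hf] (e : set N) : exists f : W -> F,
    [/\ lin f, forall w, f w = f (pi w)
      & E e -> forall w, H w -> (beta e w <-> f w = 0)].
  have [Ee|nE] := pselect (E e); last by exists (fun=> 0); split=> //; apply: lin_cst0.
  have [k bk] := betaE e Ee; have [hk _] := hA k.
  have [phi [b [lphi _ phiP]]] := hyperplane_functional hF hk.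
  exists (fun w => phi (pi w)); split.
  - by move=> a u v; rewrite piZD lphi.
  - by move=> w; rewrite (piH (pi w)).
  - move=> _ w Hw; rewrite bk piH //; split=> [[/phiP]//|/phiP pw].
    by split.
have lf e : lin (f e) by case: (hf e).
have fpi e w : f e w = f e (pi w) by case: (hf e).
have fbeta e w : E e -> H w -> beta e w <-> f e w = 0 by move=> Ee; case: (hf e) => _ _; apply.
have bridge S X i j : finite_set S -> S `<=` E -> E [set i; j] ->
    edge_closed S X -> X i -> ~ X j ->
    exists w, [/\ H w, forall e, S e -> f e w = 0 & f [set i; j] w != 0].
  move=> fS SE Eij clX Xi nXj.
  have [w [Hw hw nw]] := synthetic_bridge hF sH s_beta brank fS SE Eij clX Xi nXj.
  exists w; split=> // [e Se|]; first by apply/fbeta; [apply: SE| |apply: hw].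
  by apply/eqP => /(fbeta _ _ Eij Hw).
have [|m [m0 mN m_circ]] := global_scaling hF sH (@edges_link _ Delta) lf bridge.
  move=> x p sp up cp w Hw hw; have Ec y := next_cycle cp (x := y).
  have lc : last x p \in x :: p by apply: mem_last.
  have /set_mem El := Ec _ lc; rewrite last_next // in El.
  apply/fbeta => //; apply: (synthetic_circuit hF sH s_beta brank sp up cp Hw) => t tp.
  apply/fbeta => //; last exact: hw.
  by apply/set_mem/Ec; rewrite lastI mem_rcons inE tp orbT.
pose adj : rel N := fun i j => [set i; j] \in E.
have adj_sym : symmetric adj by move=> i j; rewrite /adj setUC.
have adj_irr : irreflexive adj.
  move=> i; apply/negP => /set_mem/(@edges_link _ Delta)[a [b [ab]]].
  by move=> /set2_eq[[ia ib]|[ib ia]]; apply: ab; rewrite -ia -ib.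
(* Now the gain of an edge is its scaled form, acting by addition. *)
pose tau i j (y : W -> F) := fun w => y w + f [set i; j] w * m i j.
have tauK i j y : adj i j -> tau j i (tau i j y) = y.
  move=> ij; apply/funext => w; rewrite /tau (mN _ _ ij) (setUC [set j]).
  by rewrite mulrN addrK.
have tauE nx x p y w : path (frel nx) x p -> transport tau x p y w =
    y w + \sum_(t <- belast x p) f [set t; nx t] w * m t (nx t).
  elim: p x y => [|z p IH] x y /=; first by rewrite big_nil addr0.
  by move=> /andP[/eqP <- zp]; rewrite IH // big_cons /tau addrA.
have tau_circ x p y : (1 < size p)%N -> uniq (x :: p) -> cycle adj (x :: p) ->
    transport tau x (rcons p x) y = y.
  move=> sp up cp; apply/funext => w; rewrite (tauE _ _ _ _ _ (cycle_next up)).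
  rewrite belast_rcons -[RHS]addr0; congr (_ + _).
  rewrite -[RHS](m_circ x p sp up cp (pi w) (Hpi w)); apply: eq_bigr => t _.
  by rewrite fpi.
have [root [hroot rootE]] := component_roots adj_sym.
have [y [y_root y_step]] :=
  exists_potential adj_irr adj_sym tauK tau_circ (fun=> 0) hroot rootE.
have rootK v : root (root v) = root v.
  by have [p rp lp] := hroot v; rewrite (constant_on_path rootE rp) lp.
(* Each [y v] arises from 0 by adding multiples of edge forms along a path from the root. *)
have y_ind (P : (W -> F) -> Prop) : P (fun=> 0) ->
    (forall e a g, P g -> P (fun w => g w + f e w * a)) -> forall v, P (y v).
  move=> P0 PS v; have [p rp <-] := hroot v.
  apply: (path_ind (P := fun v => P (y v)) rp) (mem_last _ _); first by rewrite y_root.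
  by move=> a b _ ab Pa; rewrite (y_step _ _ ab); apply: PS.
have ly v : lin (y v).
  by apply: y_ind v => [|e a g lg]; [apply: lin_cst0|apply: lin_add lg (lin_mulr _ (lf e))].
have yw0 v : y v w0 = 0.
  apply: (y_ind (fun g => g w0 = 0)) => // e a g ->.
  by rewrite fpi piw0 lin0 // mul0r addr0.
(* The potential may be shifted by one form on each component. Components are indexed by their
   roots, and the shifts are chosen to act on the part of [H] that the [y v] do not see. *)
have [z [lz hz]] := matching_functionals hF
  [set w | H w /\ forall v, y v w = 0] [set v | root v = v].
have lx v : lin (fun w => y v w + z (root v) w) by apply: lin_add.
have [c cE] := linear_homog lx lt.
have xE v w : (c w).1 v = y v w + z (root v) w by rewrite cE.
have tE w : (c w).2 = theta w by rewrite cE.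
have x_edge i j w : adj i j -> (c w).1 j - (c w).1 i = f [set i; j] w * m i j.
  move=> ij; rewrite !xE (rootE _ _ ij) (y_step _ _ ij) /tau.
  by rewrite opprD addrACA subrr addr0 addrAC subrr add0r.
(* The gain of [A k] is the coordinate difference at its point [we k], where [theta] is 1. *)
have gainN k i j : en k = [set i; j] ->
    (c (we k)).1 i - (c (we k)).1 j = - ((c (we k)).1 j - (c (we k)).1 i).
  by move=> _; rewrite opprB.
have en_link k : is_link (en k) by case: (hen k) => /edges_link.
exists c, (GainGraph en_link gainN); split.
- split.
    apply/seteqP; split=> w; rewrite /preimage /homog_ideal /= tE => /tH //.
  case: hz => [sep|[b hb]]; [left|right].
    (* At a root [y] is zero, so equal coordinates make every [z] at a root vanish on [u - v], and
       then every [y]; separation applies. *)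
    move=> u v cuv; apply/eqP; rewrite -subr_eq0; apply/eqP.
    have c0 : c (u - v) = 0 by rewrite raddfB /= cuv subrr.
    have x0 t : y t (u - v) + z (root t) (u - v) = 0 by rewrite -xE c0.
    have z0 t : root t = t -> z t (u - v) = 0.
      by move=> rt; have := x0 t; rewrite -{1}rt y_root add0r rt.
    apply: sep => //; split; first by apply/tH; rewrite -tE c0.
    by move=> t; have := x0 t; rewrite z0 ?addr0.
  (* The point is assembled from [w0], which sets the last coordinate, [w1] in [H], which sets the
     differences along paths from the roots, and dual vectors [b], which set the values at the roots
     without changing the rest. *)
  move=> s p; pose q := p.1.
  have /choice[P hP] v : exists P, path adj (root v) P /\ last (root v) P = v.
    by have [P ? ?] := hroot v; exists P.
  pose L := flatten [seq pairmap pair (root v) (P v) | v <- s].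
  have pm_adj x r : path adj x r -> forall ij, ij \in pairmap pair x r -> adj ij.1 ij.2.
    elim: r x => //= t r IH x /andP[xt tr] ij; rewrite inE => /predU1P[->//|].
    exact: IH.
  have LE ij : ij \in L -> E [set ij.1; ij.2].
    move=> /flattenP[_ /mapP[v _ ->]] ijv; apply/set_mem.
    by apply: pm_adj ijv; case: (hP v).
  have [|w1 [Hw1 hw1]] := interpolation hF (y := y) q sH ly _ LE.
    move=> S X i j fS SE Eij clX Xi nXj.
    have [w [Hw hw nw]] := bridge S X i j fS SE Eij clX Xi nXj.
    have ij : adj i j by apply: mem_set.
    exists w; split=> // [a a' aS|].
      have aa' : adj a a' by apply/mem_set/SE.
      by rewrite (y_step _ _ aa') /tau hw // mul0r addr0.
    rewrite (y_step _ _ ij) /tau => /eqP; rewrite -subr_eq0 opprD addNKr oppr_eq0.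
    by rewrite skew_mulf_eq0 // (negbTE nw) (negbTE (m0 _ _ ij)).
  have telescope x r : (forall ij, ij \in pairmap pair x r ->
      y ij.2 w1 - y ij.1 w1 = q ij.2 - q ij.1) ->
      y (last x r) w1 - y x w1 = q (last x r) - q x.
    elim: r x => [|t r IH] x /= h; first by rewrite !subrr.
    have := h (x, t); rewrite mem_head => /(_ isT) /= hxt.
    have htr : y (last t r) w1 - y t w1 = q (last t r) - q t.
      by apply: IH => ij ijr; apply: h; rewrite inE ijr orbT.
    by rewrite -[LHS](subrKA (y t w1)) htr hxt subrKA.
  have yw1 v : v \in s -> y v w1 = q v - q (root v).
    move=> vs; have [_ lv] := hP v; have := telescope (root v) (P v).
    rewrite lv y_root subr0; apply=> ij ijv; apply: hw1.
    by apply/flattenP; exists (pairmap pair (root v) (P v)) => //; apply: map_f.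
  pose u := p.2 *: w0 + w1; pose rs := undup [seq root v | v <- s].
  pose d := \sum_(r <- rs) (q r - z r u) *: b (root r).
  have KD r : [/\ H (b (root r)), forall v, y v (b (root r)) = 0 &
      forall v, root v = v -> z v (b (root r)) = (v == root r)%:R].
    by have [[? ?] ?] := hb (root r) (rootK r); split.
  exists (d + u); split.
    rewrite tE linD // lin_sum // big1 ?add0r => [|r _]; last first.
      by have [/tH h _ _] := KD r; rewrite linZ // h mulr0.
    by rewrite lt tw0 mulr1 (tH w1).1 // addr0.
  move=> v vs; rewrite xE (linD _ _ (ly v)) (linD _ _ (lz _)) !lin_sum //.
  rewrite big1 ?add0r => [|r _]; last first.
    by have [_ h _] := KD r; rewrite linZ // h mulr0.
  have rvs : root v \in rs by rewrite mem_undup map_f.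
  rewrite (bigD1_seq (root v)) ?undup_uniq //= big1_seq => [|r /andP[rv rrs]]; last first.
    have [_ _ h] := KD r; rewrite linZ // h //.
    have : root r = r by move: rrs; rewrite mem_undup => /mapP[t _ ->]; rewrite rootK.
    by move=> ->; rewrite eq_sym (negbTE rv) mulr0.
  have [_ _ h] := KD (root v); rewrite linZ // h // !rootK eqxx mulr1 addr0 subrK.
  by rewrite {1}/u ly yw0 mulr0 add0r yw1 // subrK.
- rewrite /simplification_is; apply/seteqP; split=> e /=.
    move=> Ee; have [k _ bk] := bfun e Ee; exists k => //.
    have [Ek bek] := hen k; apply: binj; rewrite ?inE //.
    by rewrite bek.
  by move=> [k _ <-]; case: (hen k).
- move=> k; have [Ek bek] := hen k; have [Awe twe] := hwe k.
  (* Subtracting a multiple of the point [we k] moves [w] into [H] without changing its membership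
     in [A k], which is then decided by the form of the edge. *)
  pose u w := w - theta w *: we k.
  have Hu w : H (u w) by apply/tH; rewrite /u linB // linZ // twe mulr1 subrr.
  have Au w : A k w <-> A k (u w).
    rewrite /u; split=> h; first by apply: subspaceB => //; apply: subspaceZ.
    have -> : w = theta w *: we k + (w - theta w *: we k) by rewrite addrC subrK.
    by apply: subspaceD => //; apply: subspaceZ.
  have key i j w : en k = [set i; j] -> (A k w <->
      (c w).1 j - (c w).1 i = theta w * ((c (we k)).1 j - (c (we k)).1 i)).
    move=> kij; have ij : adj i j by apply/mem_set; rewrite -kij.
    have Eij : E [set i; j] by rewrite -kij.
    have -> : A k w <-> f [set i; j] (u w) = 0.
      rewrite Au -(fbeta _ _ Eij (Hu w)) -kij bek /ideal_part.
      by split=> [h|[]//]; apply: conj h (Hu w).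
    rewrite !x_edge // mulrA -linZ //.
    have fu : f [set i; j] (u w) = f [set i; j] w - f [set i; j] (theta w *: we k).
      by rewrite linB.
    rewrite fu; split=> /eqP; first by rewrite subr_eq0 => /eqP ->.
    by rewrite -subr_eq0 -mulrBl skew_mulf_eq0 // (negbTE (m0 _ _ ij)) orbF => /eqP.
  apply/seteqP; split=> w; rewrite /affinographic /= tE.
    by move=> Aw i j kij; apply/key.
  have [i [j [_ kij]]] := en_link k.
  by move=> /(_ i j kij) h; apply/(key i j).
Qed.

(** * Coordinatized arrangements are synthetic *)

Lemma codim_functionals (F : unitRingType) (W : lmodType F) (H U : set W) r
    (h : 'I_r -> W -> F) (b : 'I_r -> W) :
    (forall k, lin (h k)) -> subspace H -> (forall k, H (b k)) ->
    (forall k l, h k (b l) = (k == l)%:R) ->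
    (forall w, U w <-> H w /\ forall k, h k w = 0) ->
  codim H U r.
Proof.
move=> lh sH Hb hb UE; split=> [w /UE[]//|].
have hsum k (a : {ffun 'I_r -> F}) : h k (\sum_(l < r) a l *: b l) = a k.
  rewrite lin_sum // (bigD1 k) //= linZ // hb eqxx mulr1 big1 ?addr0 // => l lk.
  by rewrite linZ // hb eq_sym (negbTE lk) mulr0.
exists b; split=> // w Hw; exists [ffun k => h k w]; split.
  apply/UE; split; last by move=> k; rewrite linB // hsum ffunE subrr.
  by apply: subspaceB => //; apply: subspace_sum => // k; apply: subspaceZ.
move=> a /UE[_ ha]; apply/ffunP => k; have /eqP := ha k.
by rewrite linB // hsum subr_eq0 ffunE => /eqP.
Qed.

Lemma functional_hyperplane (F : unitRingType) (W : lmodType F) (f : W -> F) b :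
  lin f -> f b = 1 -> hyperplane [set w | f w = 0].
Proof.
move=> lf fb; split; first exact: ker_subspace.
apply: (codim_functionals (h := fun=> f) (b := fun=> b)) => //.
  by move=> k l; rewrite !ord1.
by move=> w; split=> [fw|[_ /(_ ord0)]]; first split.
Qed.

(** [X] consists of the nodes reached from [i] without the edge; a path on to [j] would close up
    with the edge to a cycle. *)
Lemma forest_separation (N : choiceType) (T : set (set N)) i j :
    forest T -> T [set i; j] -> i <> j ->
  exists X, [/\ edge_closed (T `\ [set i; j]) X, X i & ~ X j].
Proof.
move=> fT Tij ij; pose T' := T `\ [set i; j].
pose adj : rel N := fun a b => [set a; b] \in T'.
exists [set v | exists2 p, path adj i p & last i p = v]; split.
- move=> a b Tab [p ip lp]; exists (rcons p b); last by rewrite last_rcons.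
  by rewrite rcons_path ip lp; apply: mem_set.
- by exists [::].
move=> [p ip]; case: (shortenP ip) => q iq uq _ lq.
have q1 : (1 < size q)%N.
  case: q iq lq {uq} => [|a [|//]] //= /andP[/set_mem[_ /= nij] _] aj.
  by case: nij; rewrite aj.
have /negP := fT (i :: q) q1 uq; apply.
rewrite /= rcons_path lq; apply/andP; split; last by apply/mem_set; rewrite setUC.
by apply: sub_path iq => a b /set_mem[Tab _]; apply: mem_set.
Qed.

(** If [X] separated the ends of an edge of [S], [forest_bridge] would enlarge the maximal forest
    [T]. *)
Lemma max_forest_closed (N : choiceType) (S T : set (set N)) r X i j :
    (forall T', T' `<=` S -> forest T' -> (T' #<= `I_r)%card) ->
    T `<=` S -> forest T -> (T #= `I_r)%card -> S [set i; j] ->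
  edge_closed T X -> X i -> X j.
Proof.
move=> maxT TS fT Tr Sij clX Xi; apply: contrapT => nXj.
have nT : ~ T [set i; j] by move=> /clX /(_ Xi).
have := maxT ([set i; j] |` T) _ (forest_bridge fT clX Xi nXj).
rewrite (card_le_eql (card_setU1 Tr nT)) card_le_II ltnn.
by have sub : [set i; j] |` T `<=` S by [move=> e [->|/TS]]; move=> /(_ sub).
Qed.

Lemma finite_set_enum (T : choiceType) (x0 : T) (A : set T) r :
    (A #= `I_r)%card ->
  exists t : 'I_r -> T, injective t /\ forall x, A x <-> exists k, t k = x.
Proof.
move=> Ar; have fA : finite_set A by apply/finite_setP; exists r.
pose s : seq T := fset_set A.
have ss : size s = r by apply: card_fset_set.
have us : uniq s by apply: fset_uniq.
exists (fun k => nth x0 s k); split=> [k l /eqP|x].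
  by rewrite nth_uniq ?ss // => /eqP/val_inj.
have As : A x <-> x \in s.
  by rewrite /s in_fset_set //; split=> [/mem_set|/set_mem].
rewrite As; split=> [xs|[k <-]]; last by rewrite mem_nth ?ss.
have ix : (index x s < r)%N by rewrite -ss index_mem.
by exists (Ordinal ix) => /=; rewrite nth_index.
Qed.

Section Coordinatized.
Variables (F : unitRingType) (hF : skew_field F) (N : choiceType).
Let W := homog F N.

(** The common ideal part of all hyperplanes with edge [e], whatever their gains. *)
Definition ideal_edge (e : set N) : set (homog F N) :=
  [set w | w.2 = 0 /\ forall i j, e = [set i; j] -> w.1 i = w.1 j].

Lemma lin_difference i j : lin (fun w : W => w.1 j - w.1 i).
Proof.
move=> a u v; rewrite /= /GRing.scale /= /GRing.scale /=.
by rewrite mulrBr opprD addrACA.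
Qed.

Lemma lin_height : lin (fun w : W => w.2).
Proof. by []. Qed.

Lemma ideal_edgeE (i j : N) (w : W) :
  ideal_edge [set i; j] w <-> w.2 = 0 /\ w.1 j - w.1 i = 0.
Proof.
split=> -[w2 h]; split=> //; first by rewrite (h i j) ?subrr.
move=> a b /set2_eq[[<- <-]|[<- <-]]; apply/eqP.
  by rewrite eq_sym -subr_eq0 h.
by rewrite -subr_eq0 h.
Qed.

Definition indicator (X : set N) : W := (fun v => `[< X v >]%:R, 0).

(** A node of [e] outside [e'] is detected by the indicator of its singleton. This makes the map
    from edges to ideal parts injective. *)
Lemma ideal_edge_sub e e' : is_link e -> ideal_edge e' `<=` ideal_edge e ->
  e `<=` e'.
Proof.
move=> [i [j [ij ->]]] sub v ve; apply: contrapT => nve'.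
have : ideal_edge e' (indicator [set v]).
  split=> // a b e'ab /=; rewrite !asboolF // => av; apply: nve'.
    by rewrite e'ab -av; right.
  by rewrite e'ab -av; left.
move=> /sub/ideal_edgeE[_ /=].
have vij : v = i \/ v = j by [].
have ji : j <> i by move=> /esym.
case: vij => ->; rewrite (asboolT (erefl _)) asboolF // ?subr0 ?sub0r => /eqP;
  by rewrite ?oppr_eq0 oner_eq0.
Qed.

(** A maximal forest [T] supplies a dual system: the coordinate differences along its edges and the
    indicators of one side of each fundamental cut. The other edges of [S] add no condition because
    [T] spans. *)
Lemma ideal_edge_codim (S : set (set N)) r :
    (forall e, S e -> is_link e) -> graphic_rank S r ->
  codim (@homog_ideal F N) (@homog_ideal F N `&` \bigcap_(e in S) ideal_edge e) r.
Proof.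
move=> linkS [[T [TS fT Tr]] maxT].
have [t [tinj tT]] := finite_set_enum set0 Tr.
have /choice[ij hij] k : exists ij : N * N, t k = [set ij.1; ij.2] /\ ij.1 <> ij.2.
  have Ttk : T (t k) by apply/tT; exists k.
  by have [i [j [ne ->]]] := linkS _ (TS _ Ttk); exists (i, j).
have /choice[X hX] k : exists X, [/\ edge_closed (T `\ t k) X, X (ij k).1 & ~ X (ij k).2].
  have [tk ne] := hij k; rewrite tk; apply: forest_separation => //.
  by rewrite -tk; apply/tT; exists k.
apply: (codim_functionals (h := fun k (w : W) => w.1 (ij k).2 - w.1 (ij k).1)
  (b := fun k => indicator (~` X k))).
- by move=> k; apply: lin_difference.
- by case: (homog_ideal_hyperplane F N).
- by [].
- move=> k l; rewrite /indicator /=; have [clX Xi nXj] := hX l.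
  have [->|kl] := eqVneq k l.
    by rewrite asboolT // asboolF ?subr0.
  have Tk : (T `\ t l) [set (ij k).1; (ij k).2].
    have [<- _] := hij k; split; first by apply/tT; exists k.
    by move=> /tinj kl'; rewrite kl' eqxx in kl.
  have clC := edge_closedC clX.
  have -> : `[< (~` X l) (ij k).2 >] = `[< (~` X l) (ij k).1 >].
    apply: asbool_equiv_eq; split; last exact: clC Tk.
    by apply: clC; rewrite setUC.
  by rewrite subrr.
- move=> w; split=> [[w2 hw]|[w2 hw]]; split=> //.
    move=> k; have Sk : S (t k) by apply: TS; apply/tT; exists k.
    by have := hw _ Sk; have [-> _] := hij k; move=> /ideal_edgeE[].
  move=> e Se; have [i [j [_ eij]]] := linkS e Se; rewrite eij in Se *.
  apply/ideal_edgeE; split=> //.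
  pose Y := [set v | w.1 v = w.1 i].
  suff : Y j by rewrite /Y /= => ->; rewrite subrr.
  apply: (max_forest_closed maxT TS fT Tr Se) => //.
  move=> a b /tT[k]; have [-> _] := hij k.
  have /eqP := hw k; rewrite subr_eq0 => /eqP wk.
  by move=> /set2_eq[[<- <-]|[<- <-]]; rewrite /Y /= wk.
Qed.

Lemma coordinatized_synthetic (E : Type) (Phi : gain_graph F N E) :
  synthetic_affinographic (affine_space F N)
    (affinographic (@id (homog F N)) Phi).
Proof.
have range_link e : range (ends Phi) e -> is_link e.
  by move=> [k _ <-]; apply: ends_link.
have affE k i j : ends Phi k = [set i; j] -> forall w,
    affinographic (@id (homog F N)) Phi k w <->
    w.1 j - w.1 i - w.2 * gain Phi k i j = 0.
  move=> kij w; split=> [/(_ i j kij) ->|/eqP]; first by rewrite subrr.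
  rewrite subr_eq0 => /eqP h a b; rewrite kij => /set2_eq[[<- <-]//|[<- <-]].
  by rewrite (gainN kij) mulrN -h opprB.
have partE k : ideal_part (affine_space F N) (affinographic (@id (homog F N)) Phi k) =
    ideal_edge (ends Phi k).
  have [i [j [_ kij]]] := ends_link Phi k; rewrite kij.
  apply/seteqP; split=> w.
    move=> [/(affE k i j kij) h w2]; apply/ideal_edgeE; split=> //.
    by move: h; rewrite [w.2]w2 mul0r subr0.
  move=> /ideal_edgeE[w2 h]; split=> //; apply/(affE k i j kij).
  by rewrite h w2 mul0r subr0.
exists N, (SimpleGraph range_link); split.
  move=> k; have [i [j [ij kij]]] := ends_link Phi k.
  have -> : affinographic (@id (homog F N)) Phi k =
      [set w | w.1 j - w.1 i - w.2 * gain Phi k i j = 0].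
    by apply/seteqP; split=> w /(affE k i j kij).
  have fb : (indicator [set j]).1 j - (indicator [set j]).1 i -
      (indicator [set j]).2 * gain Phi k i j = 1.
    by rewrite /= asboolT // asboolF // mul0r !subr0.
  split.
    pose phi (w : W) : F := w.1 j - w.1 i - w.2 * gain Phi k i j.
    apply: (functional_hyperplane (f := phi) _ fb).
    apply: lin_add (lin_opp (lin_mulr _ lin_height)); exact: lin_difference.
  (* The indicator of the singleton of [j] is ideal but violates the equation, so the hyperplane is
     not the ideal one. *)
  move=> /seteqP[_ /(_ (indicator [set j]) erefl)].
  by rewrite /= -[X in X = _]/(_ - _ - _) fb => /eqP; rewrite oner_eq0.
exists ideal_edge; split; last first.
  by move=> S r SE _; apply: ideal_edge_codim => e /SE /range_link.
split.
- by move=> _ [k _ <-]; exists k => //; rewrite partE.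
- move=> e e' /set_mem/range_link le /set_mem/range_link le' ee'.
  by apply/seteqP; split; apply: ideal_edge_sub => // w; rewrite ee'.
- by move=> _ [k _ <-]; exists (ends Phi k); [exists k|rewrite partE].
Qed.

End Coordinatized.

Theorem theorem3p10 (F : unitRingType) (hF : skew_field F) :
  (forall (G : affine_geometry F) (I : Type) (A : I -> set (proj G))
          (N : choiceType) (Delta : simple_graph N),
     synthetic_affinographic_with G A Delta ->
     exists (c : {linear proj G -> homog F N}) (Phi : gain_graph F N I),
       [/\ affine_coordinates G c,
           simplification_is Phi Delta
         & forall e : I, A e = affinographic c Phi e]) /\
  (forall (N : choiceType) (E : Type) (Phi : gain_graph F N E),
     synthetic_affinographic (affine_space F N)
       (affinographic (@id (homog F N)) Phi)).
Proof.
split; first by move=> G I A N Delta; apply: synthetic_coordinates.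
by move=> N E Phi; apply: coordinatized_synthetic.
Qed.
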